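(* Let $m\ge1$, let $r$ be a positive integer, let $n_1,\ldots,n_m\in\mathbb{N}$ and $\tau_0,\tau_1,\ldots,\tau_m\in\mathbb{N}_0$ satisfy $0\le\tau_0-\tau_m\le n_m$ and $n_m+\tau_m\ge\tau_{j+1}>n_j+\tau_j$ for $j=1,\ldots,m-1$, and put $N=\sum_{j=1}^m n_j$. Then \[ \left|\frac{N!\,(-r)^N}{n_1!\cdots n_m!}\,\gamma-\sum_{k=0}^N(-1)^k\binom{N}{k}\binom{rk+n_1+\tau_1}{n_1}\cdots\binom{rk+n_m+\tau_m}{n_m}S_{rk+\tau_0}\right| \] \[ \le\prod_{j=1}^m\binom{n_m+\tau_m-\tau_j}{n_j}\int_0^1\!\!\int_0^1\frac{x^{n_m+\tau_m}(1-x^r)^Nt^{n_m+\tau_m-\tau_0}(1-t)^{\tau_0-\tau_m}\omega(t)}{(1-t+xt)^{n_m+1}}\,dx\,dt . \]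
   Context: $\gamma$ is Euler's constant; $S_n=\sum_{k=1}^n\frac1k-\log(n+1)$; $\omega(t)=\frac{1}{t(\log^2(1/t-1)+\pi^2)}$ for $t\in(0,1)$. *)

(* Defs.v *)
From mathcomp Require Import all_boot all_order all_algebra.
From mathcomp Require Import all_classical all_reals all_analysis.
Import Order.TTheory GRing.Theory Num.Theory.
Import numFieldNormedType.Exports.

Set Implicit Arguments.
Unset Strict Implicit.
Unset Printing Implicit Defensive.

Local Open Scope classical_set_scope.
Local Open Scope ring_scope.

Definition euler_gamma (R : realType) : R :=
  limn (fun n : nat => (\sum_(1 <= k < n.+1) k%:R^-1) - ln n%:R : R).

Definition euler_S (R : realType) (n : nat) : R :=
  (\sum_(1 <= k < n.+1) k%:R^-1) - ln n.+1%:R.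

Definition omega (R : realType) (t : R) : R :=
  1 / (t * (ln (1 / t - 1) ^+ 2 + pi ^+ 2)).

(* Main.v *)
(* Write s = 1 - t + x t and K_n(t) = \int_0^1 x^n / s dx.

   The left-hand side, multiplied by n_1! ... n_m!, is
   \sum_k (-1)^k C(N,k) \prod_e (rk + e + 1) (gamma - S_{rk+tau_0}), where e runs
   over the N integers tau_j, ..., tau_j + n_j - 1, because the N-th difference
   of a polynomial of degree N only sees its leading coefficient.  Since
   gamma - S_n = \int_0^1 omega(t) K_n(t) dt, this is the integral against
   omega of \int_0^1 \prod_e (x d/dx + e + 1) [(1 - x^r)^N] x^{tau_0} / s dx.
   The factors are moved one by one to x^{tau_0} / s by integration by parts;
   boundary terms vanish because fewer than N factors are left on (1 - x^r)^N.
   For a well-chosen order of the factors each step acts on x^c / s^d with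
   coefficients of constant sign, which gives the bound.

   The formula for gamma - S_n rests on
   pi omega(t) = \int_0^1 sin(pi s) ((1 - t)/t)^s ds and on Euler's reflection
   formula sin(pi s) \int_0^1 ((1 - t)/t)^s dt = pi s.  The latter is obtained by
   comparing \int (t (1 - t))^n ((1 - t)/t)^s dt with
   \int_0^{pi/2} cos(x)^{2n} cos(2 s x) dx: their product satisfies a recurrence in
   n independent of s, and is asymptotically independent of s.  Expanding K_n
   in powers of t then leaves a telescoping series. *)
Require Import Defs.
From mathcomp Require Import all_boot all_order all_algebra.
From mathcomp Require Import all_classical all_reals all_analysis measurable_realfun.
From mathcomp Require Import ring lra zify.
Import Order.TTheory GRing.Theory Num.Theory.
Import numFieldNormedType.Exports.

Set Implicit Arguments.
Unset Strict Implicit.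
Unset Printing Implicit Defensive.

Local Open Scope classical_set_scope.
Local Open Scope ring_scope.

(** * Finite differences *)

(** This is [(-1)^N] times the N-th forward difference of [W] at 0, whence the factor [(- a) ^+ N]
    in [diff_sum_prod]. *)
Definition diff_sum {R : realType} (N : nat) (W : nat -> R) : R :=
  \sum_(0 <= k < N.+1) (-1) ^+ k * 'C(N, k)%:R * W k.

(** Absorption [k C(N+1, k) = (N+1) C(N, k-1)]: a factor [k] lowers the order of the difference by
    one and shifts the argument. *)
Lemma diff_sum_mulk {R : realType} (N : nat) (W : nat -> R) :
  diff_sum N.+1 (fun k => k%:R * W k)
  = - N.+1%:R * diff_sum N (fun k => W k.+1).
Proof.
rewrite /diff_sum big_nat_recl// mul0r mulr0 add0r mulr_sumr.
apply: eq_bigr => k _.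
have -> : (-1) ^+ k.+1 * 'C(N.+1, k.+1)%:R * (k.+1%:R * W k.+1)
  = (-1) ^+ k.+1 * ((k.+1 * 'C(N.+1, k.+1))%:R : R) * W k.+1.
  by rewrite natrM; ring.
by rewrite -mul_bin_diag natrM exprS; ring.
Qed.

Lemma diff_sum1 {R : realType} (N : nat) :
  diff_sum N (fun=> 1 : R) = (N == 0%N)%:R.
Proof.
rewrite /diff_sum big_mkord.
transitivity ((1 - 1 : R) ^+ N); last by rewrite subrr expr0n.
rewrite exprBn; apply: eq_bigr => k _.
by rewrite !expr1n !mulr1 mulr_natr.
Qed.

Lemma diff_sumZD {R : realType} (N : nat) (a b : R) (V W : nat -> R) :
  diff_sum N (fun k => a * V k + b * W k) = a * diff_sum N V + b * diff_sum N W.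
Proof.
rewrite /diff_sum !mulr_sumr -big_split/=; apply: eq_bigr => k _; ring.
Qed.

(** Induction on the number of factors. In one factor [a k + e], the constant part leaves too few
    factors for the order and contributes 0; the part [a k] lowers the order, and the resulting
    shift of [k] is absorbed by replacing every other [e] by [a + e]. *)
Lemma diff_sum_prod {R : realType} (a : R) (es : seq R) (N : nat) :
  (size es <= N)%N ->
  diff_sum N (fun k => \prod_(e <- es) (a * k%:R + e))
  = if size es == N then N`!%:R * (- a) ^+ N else 0.
Proof.
move sE: (size es) => s; elim: s es sE N => [|s IH] [|e es]//= sE N.
  move=> _; rewrite -[LHS](_ : diff_sum N (fun=> 1) = _); last first.
    by congr diff_sum; apply/funext => k; rewrite big_nil.
  by rewrite diff_sum1; case: N => [|N] //=; rewrite fact0 expr0 mulr1.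
case: sE => sE; case: N => // N; rewrite ltnS eqSS => sN.
have -> : (fun k => \prod_(e0 <- e :: es) (a * k%:R + e0))
  = (fun k => a * (k%:R * \prod_(e <- es) (a * k%:R + e))
              + e * \prod_(e <- es) (a * k%:R + e)).
  by apply/funext => k; rewrite big_cons; ring.
rewrite diff_sumZD diff_sum_mulk (IH es)//; last exact: leqW.
rewrite ltn_eqF ?ltnS// mulr0 addr0.
have -> : (fun k => \prod_(e <- es) (a * k.+1%:R + e))
  = (fun k => \prod_(e <- [seq a + e | e <- es]) (a * k%:R + e)).
  by apply/funext => k; rewrite big_map; apply: eq_bigr => i _; rewrite -natr1; ring.
rewrite IH ?size_map//; case: eqP => _; last by rewrite !mulr0.
by rewrite factS natrM exprS; ring.
Qed.

(** * Integration by parts for alternating sums *)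

Notation leb := (@lebesgue_measure _).

Lemma ftc_cc {R : realType} (f F : R -> R) (a b : R) : a < b ->
  (forall x, a <= x <= b -> {for x, continuous f}) ->
  (forall x, a <= x <= b -> is_derive x 1 F (f x)) ->
  (\int[leb]_(x in `[a, b]) (f x)%:E = (F b - F a)%:E)%E.
Proof.
move=> ab cf dF; rewrite EFinB; apply: continuous_FTC2 => //.
- by apply: continuous_in_subspaceT => x; rewrite inE/= in_itv/=; apply: cf.
- have cF x : a <= x <= b -> {for x, continuous F}.
    move=> xab; have dFx := dF _ xab.
    by apply/differentiable_continuous/derivable1_diffP; apply: ex_derive.
  split.
  + move=> x; rewrite in_itv/= => /andP[ax xb].
    by have dFx := dF x; apply: ex_derive; apply: dFx; rewrite !ltW.
  + by apply: cvg_at_right_filter; apply: cF; rewrite lexx ltW.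
  + by apply: cvg_at_left_filter; apply: cF; rewrite lexx ltW.
- move=> x; rewrite in_itv/= => /andP[ax xb].
  by rewrite derive1E; apply: (derive_val (is_derive := dF x _)); rewrite !ltW.
Qed.

Lemma continuous_integrable_cc {R : realType} (f : R -> R) (a b : R) :
  (forall x, a <= x <= b -> {for x, continuous f}) ->
  leb.-integrable `[a, b] (EFin \o f).
Proof.
move=> cf; apply: continuous_compact_integrable; first exact: segment_compact.
by apply: continuous_in_subspaceT => x; rewrite inE/= in_itv/=; apply: cf.
Qed.

Lemma continuous_integrable_oo {R : realType} (f : R -> R) (a b : R) :
  (forall x, a <= x <= b -> {for x, continuous f}) ->
  leb.-integrable `]a, b[ (EFin \o f).
Proof.
move=> cf; have := continuous_integrable_cc cf.
by apply: integrableS => //; exact: subset_itv_oo_cc.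
Qed.

Lemma ftc_oo {R : realType} (f F : R -> R) (a b : R) : a < b ->
  (forall x, a <= x <= b -> {for x, continuous f}) ->
  (forall x, a <= x <= b -> is_derive x 1 F (f x)) ->
  \int[leb]_(x in `]a, b[) f x = F b - F a.
Proof.
move=> ab cf dF; rewrite /Rintegral -(@integral_itv_bndoo _ _ _ _ true false).
  by rewrite ftc_cc.
by apply: (measurable_int leb); exact: continuous_integrable_oo.
Qed.

Definition den {R : realType} (t x : R) : R := 1 - t + x * t.

Lemma den_gt0 {R : realType} (t x : R) : 0 < t < 1 -> 0 <= x <= 1 -> 0 < den t x.
Proof.
move=> /andP[t0 t1] /andP[x0 x1]; rewrite /den ltr_pwDl ?subr_gt0//.
by rewrite mulr_ge0// ltW.
Qed.

Definition xfrac {R : realType} (c d : nat) (t x : R) : R := x ^+ c / den t x ^+ d.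

Lemma xfrac_ge0 {R : realType} (c d : nat) (t x : R) : 0 < t < 1 -> 0 <= x <= 1 ->
  0 <= xfrac c d t x.
Proof.
move=> t01 x01; have := den_gt0 t01 x01 => s0; case/andP: x01 => x0 _.
by rewrite /xfrac divr_ge0// exprn_ge0// ltW.
Qed.

Lemma is_derive1M {R : realType} (f g : R -> R) (x df dg : R) :
  is_derive x 1 f df -> is_derive x 1 g dg ->
  is_derive x 1 (fun y => f y * g y) (df * g x + f x * dg).
Proof.
move=> dF dG; apply: (is_derive_eq (is_deriveM dF dG)).
by rewrite /GRing.scale/= addrC mulrC; congr (_ + _); rewrite mulrC.
Qed.

Lemma is_derive1X {R : realType} (f : R -> R) (n : nat) (x df : R) :
  is_derive x 1 f df ->
  is_derive x 1 (fun y => f y ^+ n) (n%:R * f x ^+ n.-1 * df).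
Proof.
move=> dF; have := is_deriveX n dF.
by rewrite exprfctE.
Qed.

Lemma is_derive1V {R : realType} (f : R -> R) (x df : R) : f x != 0 ->
  is_derive x 1 f df ->
  is_derive x 1 (fun y => (f y)^-1) (- df / f x ^+ 2).
Proof.
move=> f0 dF; apply: (is_derive_eq (is_deriveV f0 dF)).
by rewrite /GRing.scale/= mulNr mulrC mulNr.
Qed.

Lemma is_derive_xfrac {R : realType} (c d : nat) (t x : R) : 0 < t < 1 -> 0 <= x <= 1 ->
  is_derive x 1 (xfrac c.+1 d t)
    (c.+1%:R * xfrac c d t x - d%:R * t * xfrac c.+1 d.+1 t x).
Proof.
move=> t01 x01; have s0 : den t x != 0 by rewrite gt_eqF// den_gt0.
have dd : is_derive x 1 (den t) t.
  by rewrite /den; apply: is_derive_eq; rewrite /GRing.scale/=; ring.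
have dX : is_derive x 1 (fun y : R => y ^+ c.+1) (c.+1%:R * x ^+ c * 1).
  exact: is_derive1X.
have dV := @is_derive1V _ (fun y => den t y ^+ d) _ _ (expf_neq0 d s0) (is_derive1X d dd).
apply: (is_derive_eq (is_derive1M dX dV)).
rewrite /xfrac; case: d {dV} => [|d] /=.
  by rewrite !expr0 invr1; ring.
by rewrite !exprS -!natr1; field; rewrite s0 expf_neq0.
Qed.

Lemma continuous_xfrac {R : realType} (c d : nat) (t x : R) : 0 < t < 1 -> 0 <= x <= 1 ->
  {for x, continuous (xfrac c d t)}.
Proof.
move=> t01 x01; have s0 : den t x != 0 by rewrite gt_eqF// den_gt0.
have cd : {for x, continuous (den t)}.
  apply: continuousD; first exact: cvg_cst.
  by apply: continuousM; [exact: cvg_id | exact: cvg_cst].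
rewrite /xfrac; apply: continuousM.
  exact: exprn_continuous.
apply: continuousV; first by rewrite expf_neq0.
apply: (@continuous_comp _ _ _ (den t) (fun x => x ^+ d)) => //.
exact: exprn_continuous.
Qed.

(* [(\prod_e (x d/dx + e + 1)) ((1 - x ^ r) ^ N)]: the monomial [x ^ (rk)] is an
   eigenvector of [x d/dx]. *)
Definition alt_poly {R : realType} (N r : nat) (es : seq nat) : {poly R} :=
  \sum_(0 <= k < N.+1)
    ((-1) ^+ k * 'C(N, k)%:R * \prod_(e <- es) (r%:R * k%:R + (e.+1)%:R)) *: 'X^(r * k).

Lemma alt_poly_cons {R : realType} (N r e : nat) (es : seq nat) :
  alt_poly N r (e :: es)
  = 'X * (alt_poly N r es)^`() + (e.+1)%:R *: alt_poly N r es :> {poly R}.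
Proof.
rewrite /alt_poly raddf_sum/= mulr_sumr scaler_sumr -big_split/=.
apply: eq_bigr => k _; rewrite derivZ derivXn big_cons -[in X in _ = X + _]scalerAr.
have -> : 'X * ('X^((r * k).-1) *+ (r * k)) = (r%:R * k%:R) *: 'X^(r * k) :> {poly R}.
  rewrite -natrM; case: (r * k)%N => [|j]; first by rewrite mulr0n mulr0 scale0r.
  by rewrite /= -mulr_natr mulrA -exprS mulr_natr scaler_nat.
rewrite !scalerA -scalerDl; congr (_ *: _); ring.
Qed.

Lemma horner_alt_poly {R : realType} (N r : nat) (es : seq nat) (x : R) :
  (alt_poly N r es).[x] = \sum_(0 <= k < N.+1)
    (-1) ^+ k * 'C(N, k)%:R * \prod_(e <- es) (r%:R * k%:R + (e.+1)%:R) * x ^+ (r * k).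
Proof.
rewrite /alt_poly horner_sum; apply: eq_bigr => k _.
by rewrite hornerZ hornerXn.
Qed.

(** The value at 1 is an N-th difference of a polynomial of degree [size es < N]. This kills the
    boundary term at 1 in the integration by parts. *)
Lemma alt_poly1 {R : realType} (N r : nat) (es : seq nat) : (size es < N)%N ->
  (alt_poly N r es).[1] = 0 :> R.
Proof.
move=> sN; rewrite horner_alt_poly.
have := @diff_sum_prod R r%:R [seq e.+1%:R | e <- es] N.
rewrite size_map ltnW// ltn_eqF// => /(_ isT) h; rewrite -[RHS]h.
by rewrite /diff_sum; apply: eq_bigr => k _; rewrite expr1n mulr1 big_map.
Qed.

Lemma alt_poly_nil {R : realType} (N r : nat) (x : R) :
  (alt_poly N r [::]).[x] = (1 - x ^+ r) ^+ N.
Proof.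
rewrite horner_alt_poly big_mkord exprBn; apply: eq_bigr => k _.
by rewrite big_nil expr1n !mulr1 exprM mulr_natr mulrnAl.
Qed.

Definition alt_int {R : realType} (N r : nat) (es : seq nat) (c d : nat) (t : R) : R :=
  \int[leb]_(x in `]0, 1[) ((alt_poly N r es).[x] * xfrac c d t x).

Lemma continuous_alt {R : realType} (p : {poly R}) (c d : nat) (t x : R) :
  0 < t < 1 -> 0 <= x <= 1 ->
  {for x, continuous (fun x => p.[x] * xfrac c d t x)}.
Proof.
move=> t01 x01; apply: continuousM; last exact: continuous_xfrac.
exact: continuous_horner.
Qed.

Lemma integrable_alt {R : realType} (p : {poly R}) (c d : nat) (t : R) : 0 < t < 1 ->
  leb.-integrable `]0, 1[ (EFin \o (fun x => p.[x] * xfrac c d t x)).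
Proof.
by move=> t01; apply: continuous_integrable_oo => x; exact: continuous_alt.
Qed.

(* The adjoint of [x d/dx + e + 1] is [- (x d/dx - e)]. *)
Lemma alt_int_rec {R : realType} (N r e : nat) (es : seq nat) (c d : nat) (t : R) :
  0 < t < 1 -> (size es < N)%N ->
  alt_int N r (e :: es) c d t
  = - ((c%:R - e%:R) * alt_int N r es c d t
       - d%:R * t * alt_int N r es c.+1 d.+1 t).
Proof.
move=> t01 sN; set p : {poly R} := alt_poly N r es.
pose f x := (alt_poly N r (e :: es)).[x] * xfrac c d t x
  + ((c%:R - e%:R) * (p.[x] * xfrac c d t x)
     - d%:R * t * (p.[x] * xfrac c.+1 d.+1 t x)).
have intp i j (a : R) : leb.-integrable `]0, 1[
    (EFin \o (fun x => a * (p.[x] * xfrac i j t x))).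
  by have /(integrableZl _ a) h := integrable_alt p i j t01; exact: h.
have cf (x : R) : 0 <= x <= 1 -> {for x, continuous f}.
  move=> x01; apply: continuousD; first exact: continuous_alt.
  by apply: continuousB; apply: continuousM; try exact: cvg_cst;
    exact: continuous_alt.
have df (x : R) : 0 <= x <= 1 -> is_derive x 1 (fun x => p.[x] * xfrac c.+1 d t x) (f x).
  move=> x01; have dm := is_derive_xfrac c d t01 x01.
  apply: (is_derive_eq (is_derive1M (is_derive_poly p x) dm)).
  rewrite /f alt_poly_cons -/p hornerD hornerM hornerX hornerZ.
  have -> : xfrac c.+1 d t x = x * xfrac c d t x by rewrite /xfrac exprS mulrA.
  by rewrite -!natr1; ring.
have := ftc_oo ltr01 cf df.
(* The boundary term at 1 vanishes by [alt_poly1], the one at 0 by the factor [x^(c+1)]. *)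
rewrite alt_poly1// mul0r /xfrac expr0n/= !mul0r mulr0 subrr -/(xfrac _ _ _ _).
rewrite /f RintegralD//; last 2 first.
- exact: integrable_alt.
- by apply: (@integrableB _ _ _ _ _ _ (EFin \o _) (EFin \o _)).
rewrite RintegralB// !RintegralZl//; try exact: integrable_alt.
by move/eqP; rewrite addr_eq0 => /eqP.
Qed.

(** Pointwise, [t x = den t x - (1 - t)]. *)
Lemma alt_int_split {R : realType} (N r : nat) (es : seq nat) (c d : nat) (t : R) :
  0 < t < 1 ->
  t * alt_int N r es c.+1 d.+1 t
  = alt_int N r es c d t - (1 - t) * alt_int N r es c d.+1 t.
Proof.
move=> t01; rewrite /alt_int -!RintegralZl//; try exact: integrable_alt.
rewrite -RintegralB//; last 2 first.
- exact: integrable_alt.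
- by have /(integrableZl _ (1 - t)) h := integrable_alt (alt_poly N r es) c d.+1 t01; exact: h.
apply: eq_Rintegral => x; rewrite inE/= in_itv/= => /andP[x0 x1].
have s0 : den t x != 0 by rewrite gt_eqF// den_gt0// !ltW.
rewrite /xfrac !exprS.
have -> : t * ((alt_poly N r es).[x] * (x * x ^+ c / (den t x * den t x ^+ d)))
  = (alt_poly N r es).[x] * (x ^+ c * (den t x - (1 - t)) / (den t x * den t x ^+ d)).
  by rewrite /den; ring.
by field; rewrite s0 expf_neq0.
Qed.

(** When [c = e + d], splitting the second term of [alt_int_rec] produces
    [d * alt_int N r es c d t], which cancels the first term. *)
Lemma alt_int_rec_diag {R : realType} (N r e : nat) (es : seq nat) (d : nat) (t : R) :
  0 < t < 1 -> (size es < N)%N ->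
  alt_int N r (e :: es) (e + d) d t
  = - (1 - t) * d%:R * alt_int N r es (e + d) d.+1 t.
Proof.
move=> t01 sN; rewrite alt_int_rec// -mulrA alt_int_split// natrD; ring.
Qed.

(** Each diagonal step raises the exponent of the denominator by one while the next [e] is one
    smaller, so the relation [c = e + d] persists with [c] fixed. *)
Lemma alt_int_down {R : realType} (N r tau a d : nat) (es : seq nat) (t : R) :
  0 < t < 1 -> (a + size es <= N)%N ->
  d`!%:R * alt_int N r (rev (iota tau a) ++ es) (tau + a + d) d.+1 t
  = (- (1 - t)) ^+ a * (d + a)`!%:R * alt_int N r es (tau + a + d) (d + a).+1 t.
Proof.
move=> t01; elim: a d => [|a IH] d sN; first by rewrite !addn0 expr0; ring.
have -> : rev (iota tau a.+1) = (tau + a)%N :: rev (iota tau a).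
  by rewrite -addn1 iotaD/= rev_cat.
have -> : (tau + a.+1 + d = tau + a + d.+1)%N by rewrite addnS addSn addnS.
rewrite cat_cons alt_int_rec_diag//; last by rewrite size_cat size_rev size_iota.
have := IH d.+1 (ltnW sN); rewrite factS natrM addSnnS => h.
transitivity (- (1 - t) * (d.+1%:R * d`!%:R
  * alt_int N r (rev (iota tau a) ++ es) (tau + a + d.+1) d.+2 t)); first by ring.
by rewrite h exprS; ring.
Qed.

(** Here [c = e] annihilates the first term of [alt_int_rec]; the surviving term has exponent
    [c.+1], which equals the next [e]. *)
Lemma alt_int_up {R : realType} (N r b d c : nat) (es : seq nat) (t : R) :
  0 < t < 1 -> (b + size es <= N)%N ->
  d`!%:R * alt_int N r (iota c b ++ es) c d.+1 t
  = t ^+ b * (d + b)`!%:R * alt_int N r es (c + b) (d + b).+1 t.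
Proof.
move=> t01; elim: b c d => [|b IH] c d sN; first by rewrite !addn0 expr0; ring.
rewrite /= alt_int_rec//; last by rewrite size_cat size_iota.
have := IH c.+1 d.+1 (ltnW sN); rewrite factS natrM !addSnnS => h.
transitivity (t * (d.+1%:R * d`!%:R * alt_int N r (iota c.+1 b ++ es) c.+1 d.+2 t)).
  by ring.
by rewrite h exprS; ring.
Qed.

(* Consuming first [tau + a - 1, ..., tau] and then [tau + a, ..., tau + a + b - 1]
   keeps a single term at each step. *)
Lemma alt_int_block {R : realType} (N r tau a b : nat) (es : seq nat) (t : R) :
  0 < t < 1 -> (a + b + size es <= N)%N ->
  alt_int N r (rev (iota tau a) ++ iota (tau + a) b ++ es) (tau + a) 1 t
  = (- (1 - t)) ^+ a * t ^+ b * (a + b)`!%:R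
    * alt_int N r es (tau + a + b) (a + b).+1 t.
Proof.
move=> t01 sN.
have := @alt_int_down _ N r tau a 0 (iota (tau + a) b ++ es) t t01.
rewrite size_cat size_iota addnA => /(_ sN).
rewrite fact0 mul1r addn0 add0n => ->.
rewrite -mulrA alt_int_up//; first by ring.
by apply: leq_trans sN; rewrite -addnA leq_addl.
Qed.

(* At the i-th step the exponent of the denominator is [d + i]; the condition
   makes the coefficient [M - (d + i) - e] nonnegative. *)
Fixpoint chain (M d : nat) (es : seq nat) : bool :=
  if es is e :: es' then (e + d <= M)%N && chain M d.+1 es' else true.

(** Combined with [alt_int_split], each step keeps the exponent [M] and gives a combination of the
    integrals at [d] and [d.+1] with weights [M - e - d] and [d * (1 - t)], up to one global sign.
    [chain] makes these weights nonnegative, so no cancellation occurs. *)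
Lemma alt_int_bounds {R : realType} (N r M d : nat) (es : seq nat) (t : R) :
  0 < t < 1 -> (size es <= N)%N -> chain M d es ->
  0 <= (-1) ^+ size es * alt_int N r es M d t
    <= \prod_(e <- es) (M%:R - e%:R) * alt_int N r [::] M d t.
Proof.
move=> t01; elim: es d => [|e es IH] d sN /=.
  move=> _; rewrite expr0 !mul1r big_nil mul1r lexx andbT.
  apply: Rintegral_ge0 => x /=; rewrite in_itv/= => /andP[x0 x1].
  by rewrite alt_poly_nil mulr_ge0 ?xfrac_ge0 ?exprn_ge0 ?subr_ge0 ?exprn_ile1 ?ltW.
case/andP => edM ch; have /andP[t0 t1] := t01.
(* The induction hypothesis is needed at [d] as well as at [d.+1]; lowering [d] preserves
   [chain]. *)
have chd : chain M d es.
  elim: (es) d ch {edM IH} => //= a l IHl d /andP[adM /IHl ->]; rewrite andbT.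
  by apply: leq_trans adM; rewrite leq_add2l.
have /andP[l1 u1] := IH _ (ltnW sN) chd.
have /andP[l2 u2] := IH _ (ltnW sN) ch.
set P := \prod_(e <- es) _ in u1 u2.
have P0 : 0 <= P.
  rewrite /P big_seq; apply: prodr_ge0 => i ies; rewrite subr_ge0 ler_nat.
  elim: (es) d {edM IH chd sN l1 u1 l2 u2 P} ch ies => //= a l IHl d /andP[adM /IHl h].
  rewrite inE => /orP[/eqP ->|/h//].
  by apply: leq_trans adM; rewrite leq_addr.
rewrite alt_int_rec// -mulrA alt_int_split// big_cons -/P exprS.
set J1 := alt_int _ _ es M d t in l1 u1 *.
set J2 := alt_int _ _ es M d.+1 t in l2 u2 *.
set B1 := alt_int _ _ [::] M d t in u1 *.
set B2 := alt_int _ _ [::] M d.+1 t in u2 *.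
(* By [alt_int_split] the difference is [t] times a nonnegative integral. Hence both terms are
   bounded by multiples of [B1], and the weights [M - e - d] and [d] add up to [M - e]. *)
have B12 : (1 - t) * B2 <= B1.
  have B0 : 0 <= alt_int N r [::] M.+1 d.+1 t.
    apply: Rintegral_ge0 => x /=; rewrite in_itv/= => /andP[x0 x1].
    by rewrite alt_poly_nil mulr_ge0 ?xfrac_ge0 ?exprn_ge0 ?subr_ge0 ?exprn_ile1 ?ltW.
  by rewrite -subr_ge0 -alt_int_split// mulr_ge0// ltW.
have -> : -1 * (-1) ^+ size es * - ((M%:R - e%:R) * J1 - d%:R * (J1 - (1 - t) * J2))
  = (M%:R - e%:R - d%:R) * ((-1) ^+ size es * J1)
    + d%:R * ((1 - t) * ((-1) ^+ size es * J2)) by ring.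
have Med : 0 <= M%:R - e%:R - d%:R :> R.
  by rewrite -addrA -opprD subr_ge0 -natrD ler_nat.
have u0 : 0 <= 1 - t by rewrite subr_ge0 ltW.
apply/andP; split.
  by apply: addr_ge0; [exact: mulr_ge0 | rewrite mulr_ge0// mulr_ge0].
have -> : (M%:R - e%:R) * P * B1 = (M%:R - e%:R - d%:R) * (P * B1) + d%:R * (P * B1).
  by ring.
apply: lerD; first exact: ler_wpM2l.
apply: ler_wpM2l => //; apply: le_trans (ler_wpM2l P0 B12).
by rewrite [leRHS]mulrCA ler_wpM2l.
Qed.

(** Along a decreasing run [e] drops by one whenever [d] grows by one, so only the value of [e + d]
    at the first entry [tau + n - 1] matters. *)
Lemma chain_block (M d tau n : nat) (es : seq nat) :
  (tau + n + d <= M.+1)%N -> chain M (d + n) es ->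
  chain M d (rev (iota tau n) ++ es).
Proof.
elim: n d => [|n IH] d; first by rewrite !addn0.
have -> : rev (iota tau n.+1) = (tau + n)%N :: rev (iota tau n).
  by rewrite -addn1 iotaD/= rev_cat.
rewrite addnS addSn ltnS => h1 h2 /=; rewrite h1/= IH//.
  by rewrite addnS ltnS.
by rewrite addSn -addnS.
Qed.

(** The last block comes first and each block is listed downwards, an order suited to [chain]. *)
Fixpoint blocks (n tau : nat -> nat) (j : nat) : seq nat :=
  if j is j'.+1 then rev (iota (tau j) (n j)) ++ blocks n tau j' else [::].

Lemma size_blocks (n tau : nat -> nat) (j : nat) :
  size (blocks n tau j) = (\sum_(1 <= i < j.+1) n i)%N.
Proof.
elim: j => [|j IH]; first by rewrite big_geq.
by rewrite [RHS]big_nat_recr//= size_cat size_rev size_iota IH addnC.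
Qed.

Lemma prod_blocks {R : realType} (n tau : nat -> nat) (j : nat) (f : nat -> R) :
  \prod_(e <- blocks n tau j) f e
  = \prod_(1 <= i < j.+1) \prod_(e <- iota (tau i) (n i)) f e.
Proof.
elim: j => [|j IH]; first by rewrite big_nil big_geq.
rewrite [RHS]big_nat_recr//= big_cat IH mulrC; congr (_ * _).
by apply: perm_big; rewrite perm_rev.
Qed.

(** A bound on the first block suffices: passing to the previous block raises [d] by the length of
    the block just left, and the gap condition lowers the entries by more than that. *)
Lemma chain_blocks (M d j : nat) (n tau : nat -> nat) :
  (forall i, (1 <= i < j)%N -> (n i + tau i < tau i.+1)%N) ->
  ((0 < j)%N -> (tau j + n j + d <= M.+1)%N) ->
  chain M d (blocks n tau j).
Proof.
elim: j d => // j IH d h1 h2 /=.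
apply: chain_block; first exact: h2.
apply: IH => [i /andP[i0 ij]|j0]; first by apply: h1; rewrite i0 ltnW.
have := h1 j; rewrite j0 ltnSn => /(_ isT); have := h2 isT; lia.
Qed.

Lemma prod_iota_up {R : realType} (k tau n : nat) :
  \prod_(e <- iota tau n) (k%:R + e.+1%:R) = ((k + n + tau) ^_ n)%:R :> R.
Proof.
elim: n => [|n IH]; first by rewrite big_nil ffactn0.
rewrite -addn1 iotaD big_cat IH/= big_seq1 addn1 addnS addSn ffactSS natrM mulrC.
by congr (_ * _); rewrite -natrD; congr _%:R; rewrite addnS addnAC addnA.
Qed.

Lemma prod_iota_down {R : realType} (M tau n : nat) : (tau + n <= M)%N ->
  \prod_(e <- iota tau n) (M%:R - e%:R) = ((M - tau) ^_ n)%:R :> R.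
Proof.
elim: n => [|n IH] h; first by rewrite big_nil ffactn0.
rewrite -addn1 iotaD big_cat IH/=; last by apply: leq_trans h; rewrite addnS.
by rewrite big_seq1 addn1 ffactnSr natrM -natrB ?subnDA//; lia.
Qed.

(** * The weight omega and beta integrals *)

(* [((1 - t) / t) ^ s] for [0 < t < 1]. *)
Definition rho {R : realType} (s t : R) : R := expR (s * ln (1 / t - 1)).

Lemma ratio_gt0 {R : realType} (t : R) : 0 < t < 1 -> 0 < 1 / t - 1.
Proof.
by move=> /andP[t0 t1]; rewrite div1r subr_gt0 invf_gt1.
Qed.

Lemma is_derive1_expR {R : realType} (g : R -> R) (x b : R) :
  is_derive x 1 g b -> is_derive x 1 (fun y => expR (g y)) (expR (g x) * b).
Proof. exact: is_derive1_comp. Qed.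

Lemma is_derive1_lnf {R : realType} (g : R -> R) (x b : R) : 0 < g x ->
  is_derive x 1 g b -> is_derive x 1 (fun y => ln (g y)) ((g x)^-1 * b).
Proof. by move=> g0; apply: is_derive1_comp; exact: is_derive1_ln. Qed.

Lemma is_derive_rho_t {R : realType} (s t : R) : 0 < t < 1 ->
  is_derive t 1 (rho s) (- s * rho s t / (t * (1 - t))).
Proof.
move=> t01; have r0 := ratio_gt0 t01; have /andP[t0 t1] := t01.
have dV : is_derive t 1 (fun y : R => y^-1) (- 1 / t ^+ 2).
  by apply: (@is_derive1V _ id); rewrite gt_eqF.
have dr : is_derive t 1 (fun y : R => 1 / y - 1) (- (t ^+ 2)^-1).
  apply: is_derive_eq; rewrite /GRing.scale/=; ring.
have dl := @is_derive1_lnf _ (fun y => 1 / y - 1) _ _ r0 dr.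
have dm : is_derive t 1 (fun y => s * ln (1 / y - 1))
   (s * ((1 / t - 1)^-1 * - (t ^+ 2)^-1)).
  by apply: (is_derive_eq (is_derive1M (is_derive_cst s t 1) dl)); rewrite mul0r add0r.
apply: (is_derive_eq (is_derive1_expR dm)).
rewrite -/(rho s t).
have t1' : 1 - t != 0 by rewrite subr_eq0 eq_sym lt_eqF.
have -> : 1 / t - 1 = (1 - t) / t by field; rewrite gt_eqF.
by field; rewrite t1' gt_eqF.
Qed.

Lemma is_derive_rho_s {R : realType} (s t : R) :
  is_derive s 1 (rho^~ t) (ln (1 / t - 1) * rho s t).
Proof.
have dm : is_derive s 1 (fun y => y * ln (1 / t - 1)) (ln (1 / t - 1)).
  apply: (is_derive_eq (is_derive1M (is_derive_id s 1) (is_derive_cst (ln (1 / t - 1)) s 1))).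
  by rewrite mulr0 mul1r addr0.
apply: (is_derive_eq (is_derive1_expR dm)).
by rewrite mulrC.
Qed.

Lemma is_derive1_continuous {R : realType} (f : R -> R) (x df : R) :
  is_derive x 1 f df -> {for x, continuous f}.
Proof.
by move=> dfx; apply/differentiable_continuous/derivable1_diffP; apply: ex_derive.
Qed.

Lemma is_derive1_mulc {R : realType} (f : R -> R) (a x df : R) :
  is_derive x 1 f df -> is_derive x 1 (fun y => f y * a) (df * a).
Proof.
move=> dF; apply: (is_derive_eq (is_derive1M dF (is_derive_cst a x 1))).
by rewrite mulr0 addr0.
Qed.

Lemma is_derive1_cmul {R : realType} (f : R -> R) (a x df : R) :
  is_derive x 1 f df -> is_derive x 1 (fun y => a * f y) (a * df).
Proof.
move=> dF; apply: (is_derive_eq (is_derive1M (is_derive_cst a x 1) dF)).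
by rewrite mul0r add0r.
Qed.

Lemma is_derive1B {R : realType} (f g : R -> R) (x df dg : R) :
  is_derive x 1 f df -> is_derive x 1 g dg ->
  is_derive x 1 (fun y => f y - g y) (df - dg).
Proof. exact: is_deriveB. Qed.

Lemma is_derive_sinM {R : realType} (a x : R) :
  is_derive x 1 (fun y => sin (a * y)) (a * cos (a * x)).
Proof.
apply: (is_derive_eq (is_derive1_comp (is_derive_sin _) (is_derive1_cmul a (is_derive_id x 1)))).
by rewrite mulr1 mulrC.
Qed.

Lemma is_derive_cosM {R : realType} (a x : R) :
  is_derive x 1 (fun y => cos (a * y)) (- (a * sin (a * x))).
Proof.
apply: (is_derive_eq (is_derive1_comp (is_derive_cos _) (is_derive1_cmul a (is_derive_id x 1)))).
by rewrite mulr1 mulrC mulrN.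
Qed.

(** With [l = ln (1 / t - 1)] the integrand is [exp(l s) sin(pi s)], which has an elementary
    antiderivative; the boundary values combine through [rho 1 t + rho 0 t = 1 / t]. *)
Lemma pi_omega {R : realType} (t : R) : 0 < t < 1 ->
  \int[leb]_(s in `]0, 1[) (sin (pi * s) * rho s t) = pi * omega t.
Proof.
move=> t01; have /andP[t0 t1] := t01; have p0 := pi_gt0 R.
set l := ln (1 / t - 1).
have D0 : l ^+ 2 + pi ^+ 2 != 0.
  by rewrite gt_eqF// ltr_wpDl ?sqr_ge0// exprn_gt0.
have df (s : R) : 0 <= s <= 1 -> is_derive s 1
    (fun s => rho s t * (l * sin (pi * s) - pi * cos (pi * s)) * (l ^+ 2 + pi ^+ 2)^-1)
    (sin (pi * s) * rho s t).
  move=> _.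
  have d1 := is_derive1_cmul l (is_derive_sinM pi s).
  have d2 := is_derive1_cmul pi (is_derive_cosM pi s).
  apply: (is_derive_eq (is_derive1_mulc _ (is_derive1M (is_derive_rho_s s t) (is_derive1B d1 d2)))).
  rewrite -/l /=; move: D0; generalize (sin (pi * s)) (cos (pi * s)) (@pi R) => S C q D0.
  by field; rewrite D0.
have cf (s : R) : 0 <= s <= 1 -> {for s, continuous (fun s => sin (pi * s) * rho s t)}.
  move=> _; apply: continuousM.
    exact: is_derive1_continuous (is_derive_sinM _ _).
  exact: is_derive1_continuous (is_derive_rho_s _ _).
have e1 : rho 1 t = 1 / t - 1 by rewrite /rho mul1r lnK// posrE ratio_gt0.
have e0 : rho 0 t = 1 by rewrite /rho mul0r expR0.
rewrite (ftc_oo ltr01 cf df) mulr0 mulr1 sin0 cos0 sinpi cospi e0 e1.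
rewrite /omega -/l.
by move: D0 p0; generalize (@pi R) => q D0 p0; field; rewrite D0 gt_eqF.
Qed.

Lemma measurable_inv {R : realType} : measurable_fun [set: R] (@GRing.inv R).
Proof.
(* This writes the inverse as a composition of measurable functions, valid at 0 too because
   [0^-1 = 0]. *)
have -> : @GRing.inv R = (fun x => x * expR (- ln (x ^+ 2))).
  apply/funext => x; have [->|x0] := eqVneq x 0; first by rewrite invr0 mul0r.
  by rewrite expRN lnK ?posrE ?exprn_even_gt0//; field.
apply: measurable_funM => //; apply: measurableT_comp; first exact: measurable_expR.
apply: measurable_funN; apply: measurableT_comp; first exact: measurable_ln.
exact: measurable_funX.
Qed.

Lemma measurable_funV {R : realType} d (T : measurableType d) (f : T -> R) :
  measurable_fun setT f -> measurable_fun setT (fun x => (f x)^-1).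
Proof. by move=> mf; apply: measurableT_comp mf; exact: measurable_inv. Qed.

Lemma measurable_rho2 {R : realType} :
  measurable_fun setT (fun z : R * R => rho z.1 z.2).
Proof.
apply: measurableT_comp; first exact: measurable_expR.
apply: measurable_funM; first exact: measurable_fst.
apply: measurableT_comp; first exact: measurable_ln.
apply: measurable_funB => //; under eq_fun do rewrite div1r.
by apply: measurable_funV; exact: measurable_snd.
Qed.

Lemma measurable_omega {R : realType} : measurable_fun setT (@omega R).
Proof.
rewrite /omega; under eq_fun do rewrite div1r.
apply: measurable_funV; apply: measurable_funM => //.
apply: measurable_funD => //; apply: measurable_funX.
apply: measurableT_comp; first exact: measurable_ln.
by apply: measurable_funB => //; under eq_fun do rewrite div1r; exact: measurable_inv.
Qed.

(* Cut-off of the improper integrals over ]0, 1[; an exponentially small one turns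
   [t ^ (1 - s)] into a quantity that obviously tends to 0. *)
Definition eps {R : realType} (j : nat) : R := expR (- j.+2%:R).

Lemma eps_gt0 {R : realType} (j : nat) : 0 < eps j :> R.
Proof. exact: expR_gt0. Qed.

Lemma expRN_le {R : realType} (x : R) : 0 <= x -> expR (- x) <= (1 + x)^-1.
Proof.
move=> x0; rewrite expRN lef_pV2 ?posrE ?expR_gt0//; first exact: expR_ge1Dx.
by rewrite ltr_pwDl.
Qed.

Lemma eps_le {R : realType} (j : nat) : eps j <= 3^-1 :> R.
Proof.
apply: le_trans (expRN_le _) _ => //; rewrite lef_pV2 ?posrE//.
by rewrite -[3]/(1 + 2%:R) lerD2l ler_nat.
Qed.

Lemma cvg_expRN {R : realType} (c : R) : 0 < c ->
  expR (- (c * j.+2%:R)) @[j --> \oo] --> (0 : R).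
Proof.
move=> c0; apply: (@squeeze_cvgr _ _ _ _ (cst 0) (fun j => c^-1 * harmonic j)).
- apply: nearW => j; rewrite expR_ge0/=.
  apply: le_trans (expRN_le _) _; first by rewrite mulr_ge0// ltW.
  have c1 : 0 < c * j.+1%:R by rewrite mulr_gt0.
  have c2 : c * j.+1%:R <= 1 + c * j.+2%:R.
    by rewrite ler_wpDl// ler_pM2l// ler_nat.
  by rewrite /harmonic -invfM lef_pV2 ?posrE// (lt_le_trans c1).
- exact: cvg_cst.
- by rewrite -[X in _ --> X](mulr0 c^-1); apply: cvgMr; exact: cvg_harmonic.
Qed.

Lemma cvg_eps {R : realType} : eps j @[j --> \oo] --> (0 : R).
Proof. by have := @cvg_expRN R 1 ltr01; under eq_fun do rewrite mul1r. Qed.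

(** * Improper integration by parts *)

Lemma measurable_oo {R : realType} (g : R -> R) :
  (forall t : R, 0 < t < 1 -> {for t, continuous g}) ->
  measurable_fun (`]0, 1[%classic : set R) g.
Proof.
move=> cg; apply: open_continuous_measurable_fun => //.
by move=> t; rewrite inE/= in_itv/=; exact: cg.
Qed.

(** The fundamental theorem on [[eps j, 1 - eps j]] is carried to the limit by monotone convergence.
    Nonnegativity stands in for integrability, so finiteness of one side can later be inferred from
    the other. *)
Lemma ge0_improper_ftc {R : realType} (F g h : R -> R) :
  (forall t : R, 0 < t < 1 -> 0 <= g t) -> (forall t : R, 0 < t < 1 -> 0 <= h t) ->
  (forall t : R, 0 < t < 1 -> {for t, continuous g}) ->
  (forall t : R, 0 < t < 1 -> {for t, continuous h}) ->
  (forall t : R, 0 < t < 1 -> is_derive t 1 F (g t - h t)) ->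
  F (eps j) @[j --> \oo] --> 0 -> F (1 - eps j) @[j --> \oo] --> 0 ->
  (\int[leb]_(t in `]0%R, 1%R[) (g t)%:E = \int[leb]_(t in `]0%R, 1%R[) (h t)%:E)%E.
Proof.
move=> g0 h0 cg ch dF F0 F1.
pose D j : set R := `[eps j, 1 - eps j]%classic.
have sD j t : D j t -> 0 < t < 1.
  rewrite /D/= in_itv/= => /andP[et te]; have := @eps_gt0 R j => e0.
  by rewrite (lt_le_trans e0 et) (le_lt_trans te)// ltrBlDr ltrDl.
have UD : \bigcup_j D j = `]0, 1[%classic.
  apply/seteqP; split => [t [j _ /sD]|t]; rewrite /= in_itv//= => /andP[t0 t1].
  have m0 : 0 < Num.min t (1 - t) by rewrite lt_min t0 subr_gt0.
  have := cvgr_lt _ (@cvg_eps R) _ m0 => -[j _ /(_ j (leqnn j))] /=.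
  rewrite lt_min => /andP[a b]; exists j => //; rewrite /D/= in_itv/= (ltW a)/=.
  by rewrite lerBrDl -lerBrDr ltW.
have hD : {homo D : n m / (n <= m)%N >-> (n <= m)%O}.
  move=> i j ij; apply/subsetPset; apply: subset_itv; rewrite bnd_simp.
    by rewrite ler_expR lerN2 ler_nat.
  by rewrite lerD2l lerN2 ler_expR lerN2 ler_nat.
have cvD (f : R -> R) : (forall t : R, 0 < t < 1 -> 0 <= f t) ->
    (forall t : R, 0 < t < 1 -> {for t, continuous f}) ->
    (\int[leb]_(x in D i) (f x)%:E)%E @[i --> \oo]
      --> (\int[leb]_(x in `]0%R, 1%R[) (f x)%:E)%E.
  move=> f0 cf; rewrite -UD; apply: ge0_nondecreasing_set_cvg_integral => //.
  - by move=> i; exact: measurable_itv.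
  - move=> i; apply/measurable_EFinP; apply: measurable_funS (measurable_oo cf) => //.
    by move=> t /sD; rewrite /= in_itv.
  - by move=> i t /sD /f0; rewrite lee_fin.
have eqD i : (\int[leb]_(x in D i) (g x)%:E
  = \int[leb]_(x in D i) (h x)%:E + (F (1 - eps i) - F (eps i))%:E)%E.
  have e12 : eps i < 1 - eps i :> R.
    by have := @eps_le R i; have := @eps_gt0 R i; lra.
  have ing (f : R -> R) : (forall t : R, 0 < t < 1 -> {for t, continuous f}) ->
      leb.-integrable (D i) (EFin \o f).
    move=> cf; apply: continuous_integrable_cc => t td; apply: cf.
    by apply: (sD i); rewrite /D/= in_itv.
  have in01 (t : R) : eps i <= t <= 1 - eps i -> 0 < t < 1.
    by move=> td; apply: (sD i); rewrite /D/= in_itv.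
  have cgh (t : R) : 0 < t < 1 -> {for t, continuous (fun t => g t - h t)}.
    by move=> t01; apply: continuousB; [exact: cg | exact: ch].
  have := ftc_cc e12 (fun t td => cgh t (in01 t td)) (fun t td => dF t (in01 t td)).
  rewrite -/(D i) => <-.
  rewrite -integralD_EFin; last 3 first.
  - exact: measurable_itv.
  - exact: ing.
  - exact: ing.
  by apply: eq_integral => t _ /=; rewrite -EFinD addrC subrK.
have c1 := cvD _ g0 cg.
have c2 : (\int[leb]_(x in D i) (g x)%:E)%E @[i --> \oo]
      --> (\int[leb]_(x in `]0%R, 1%R[) (h x)%:E + 0)%E.
  under eq_fun do rewrite eqD.
  apply: cvgeD; [by rewrite fin_num_adde_defl | exact: cvD | ].
  apply: cvg_EFin; first exact: nearW.
  by rewrite -[X in _ --> X](subrr 0); apply: cvgB.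
by have := cvg_unique _ c1 c2; rewrite adde0; apply.
Qed.

(** * Beta integrals and their recurrences *)

Definition bwt {R : realType} (s : R) (p q : nat) (t : R) : R :=
  rho s t * (t ^+ p * (1 - t) ^+ q).

Lemma integrable_cmul {R : realType} (a : R) (f : R -> R) (i : interval R) :
  leb.-integrable [set` i] (EFin \o f) ->
  leb.-integrable [set` i] (EFin \o (fun x => a * f x)).
Proof. by move=> fi; have /(integrableZl _ a) h := fi; exact: h. Qed.

(** In classical notation, the beta value [B(p + 1 - s, q + 1 + s)]. *)
Definition bet {R : realType} (s : R) (p q : nat) : R :=
  \int[leb]_(t in `]0, 1[) bwt s p q t.

Lemma bwt_ge0 {R : realType} (s : R) (p q : nat) (t : R) : 0 < t < 1 -> 0 <= bwt s p q t.
Proof.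
move=> /andP[t0 t1]; rewrite mulr_ge0 ?expR_ge0// mulr_ge0// exprn_ge0 ?subr_ge0//;
  exact: ltW.
Qed.

(** Bounding [1 / t - 1] by [1 / t] gives [rho s t <= t^(-s)]. *)
Lemma rho_mul_le {R : realType} (s t : R) : 0 <= s -> 0 < t < 1 ->
  rho s t * t <= expR ((1 - s) * ln t).
Proof.
move=> s0 t01; have /andP[t0 t1] := t01.
have -> : expR ((1 - s) * ln t) = expR (s * ln (t^-1)) * t.
  by rewrite lnV ?posrE// -[X in _ = _ * X]lnK ?posrE// -expRD; congr expR; ring.
rewrite ler_pM2r// ler_expR ler_wpM2l// ler_ln ?posrE ?ratio_gt0 ?invr_gt0//.
by rewrite div1r lerBlDr lerDl.
Qed.

Lemma rho_mul_le1 {R : realType} (s t : R) : 0 <= s < 1 -> 0 < t < 1 ->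
  rho s t * t <= 1.
Proof.
move=> /andP[s0 s1] t01; have /andP[t0 t1] := t01.
apply: le_trans (rho_mul_le s0 t01) _.
have l0 : ln t <= 0 by apply: ln_le0; exact: ltW.
by rewrite -[leRHS]expR0 ler_expR mulr_ge0_le0// subr_ge0 ltW.
Qed.

Lemma is_derive_bwt {R : realType} (s : R) (p q : nat) (t : R) : 0 < t < 1 ->
  is_derive t 1 (bwt s p.+1 q.+1)
    ((p.+1%:R - s) * bwt s p q.+1 t - (q.+1%:R + s) * bwt s p.+1 q t).
Proof.
move=> t01; have /andP[t0 t1] := t01.
have d1 : is_derive t 1 (fun y : R => y ^+ p.+1) (p.+1%:R * t ^+ p * 1).
  exact: is_derive1X.
have d2 : is_derive t 1 (fun y : R => (1 - y) ^+ q.+1) (q.+1%:R * (1 - t) ^+ q * (0 - 1)).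
  by apply: is_derive1X; apply: is_derive1B.
apply: (is_derive_eq (is_derive1M (is_derive_rho_t s t01) (is_derive1M d1 d2))).
rewrite /bwt !exprS -!natr1; field.
by rewrite subr_eq0 gt_eqF// (gt_eqF t0).
Qed.

Lemma continuous_bwt {R : realType} (s : R) (p q : nat) (t : R) : 0 < t < 1 ->
  {for t, continuous (bwt s p q)}.
Proof.
move=> t01; apply: continuousM.
  exact: is_derive1_continuous (is_derive_rho_t s t01).
apply: continuousM; first exact: exprn_continuous.
apply: (@continuous_comp _ _ _ (fun t : R => 1 - t) (fun x => x ^+ q)).
  by apply: continuousB; [exact: cvg_cst | exact: cvg_id].
exact: exprn_continuous.
Qed.

Lemma measurable_bwt {R : realType} (s : R) (p q : nat) :
  measurable_fun (`]0, 1[%classic : set R) (bwt s p q).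
Proof. by apply: measurable_oo => t; exact: continuous_bwt. Qed.

Lemma cvg_bwt_eps {R : realType} (s : R) (p q : nat) : 0 <= s < 1 ->
  bwt s p.+1 q.+1 (eps j) @[j --> \oo] --> 0 /\
  bwt s p.+1 q.+1 (1 - eps j) @[j --> \oo] --> 0.
Proof.
move=> /andP[s0 s1].
have e01 j : 0 < (eps j : R) < 1.
  by have := @eps_le R j; have := @eps_gt0 R j; lra.
have f01 j : 0 < 1 - (eps j : R) < 1.
  by have /andP[a b] := e01 j; rewrite subr_gt0 b/= ltrBlDr ltrDl.
(* The first bound is [t^(1-s)] and serves near 0; the second serves near 1. *)
have bnd (t : R) : 0 < t < 1 ->
    bwt s p.+1 q.+1 t <= expR ((1 - s) * ln t) /\ bwt s p.+1 q.+1 t <= 1 - t.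
  move=> t01; have /andP[t0 t1] := t01.
  have u0 : 0 <= 1 - t by rewrite subr_ge0 ltW.
  have rt0 : 0 <= rho s t * t by rewrite mulr_ge0 ?expR_ge0// ltW.
  have P1 : t ^+ p * (1 - t) ^+ q <= 1.
    by rewrite mulr_ile1 ?exprn_ge0 ?exprn_ile1// ?lerBlDr ?lerDl; exact: ltW.
  have P0 : 0 <= t ^+ p * (1 - t) ^+ q by rewrite mulr_ge0// exprn_ge0// ltW.
  have E : bwt s p.+1 q.+1 t = rho s t * t * ((1 - t) * (t ^+ p * (1 - t) ^+ q)).
    by rewrite /bwt !exprS; ring.
  have h1 : (1 - t) * (t ^+ p * (1 - t) ^+ q) <= 1 - t by rewrite ler_piMr.
  have h2 : (1 - t) * (t ^+ p * (1 - t) ^+ q) <= 1.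
    by apply: le_trans h1 _; rewrite lerBlDr lerDl ltW.
  split; rewrite E.
    by apply: le_trans (rho_mul_le s0 t01); rewrite ler_piMr.
  have r1 : rho s t * t <= 1 by apply: rho_mul_le1 => //; rewrite s0.
  have h0 : 0 <= (1 - t) * (t ^+ p * (1 - t) ^+ q) by rewrite mulr_ge0.
  by apply: le_trans h1; rewrite ler_piMl.
split.
- apply: (@squeeze_cvgr _ _ _ _ (cst 0) (fun j => expR (- ((1 - s) * j.+2%:R)))).
  + apply: nearW => j; rewrite bwt_ge0//=.
    by have [h _] := bnd _ (e01 j); apply: le_trans h _; rewrite /eps expRK mulrN.
  + exact: cvg_cst.
  + by apply: cvg_expRN; rewrite subr_gt0.
- apply: (@squeeze_cvgr _ _ _ _ (cst 0) eps).
  + apply: nearW => j; rewrite bwt_ge0//=.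
    by have [_ h] := bnd _ (f01 j); apply: le_trans h _; rewrite opprB addrC subrK.
  + exact: cvg_cst.
  + exact: cvg_eps.
Qed.

(** Integration by parts through [bwt s p.+1 q.+1], which vanishes at both ends. It is stated in the
    extended reals because for [p = 0] the left integrand can be unbounded near 0, and its
    integrability is deduced from this very identity. *)
Lemma bet_ibp_ereal {R : realType} (s : R) (p q : nat) : 0 <= s < 1 ->
  (\int[leb]_(t in `]0%R, 1%R[) ((p.+1%:R - s) * bwt s p q.+1 t)%:E
   = \int[leb]_(t in `]0%R, 1%R[) ((q.+1%:R + s) * bwt s p.+1 q t)%:E)%E.
Proof.
move=> s01; have /andP[s0 s1] := s01; have [c0 c1] := cvg_bwt_eps p q s01.
apply: (ge0_improper_ftc (F := bwt s p.+1 q.+1)) => //.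
- move=> t t01; rewrite mulr_ge0 ?bwt_ge0// subr_ge0 (le_trans (ltW s1))//.
  by rewrite ler1n.
- by move=> t t01; rewrite mulr_ge0 ?bwt_ge0// addr_ge0.
- by move=> t t01; apply: continuousM; [exact: cvg_cst | exact: continuous_bwt].
- by move=> t t01; apply: continuousM; [exact: cvg_cst | exact: continuous_bwt].
- by move=> t; exact: is_derive_bwt.
Qed.

Lemma integrable_bwtS {R : realType} (s : R) (p q : nat) : 0 <= s < 1 ->
  leb.-integrable `]0, 1[ (EFin \o bwt s p.+1 q).
Proof.
move=> s01; apply: (@le_integrable _ _ _ _ _ _ _ (EFin \o cst 1)) => //.
- by apply/measurable_EFinP; exact: measurable_bwt.
- move=> t; rewrite /= in_itv/= => t01; have /andP[t0 t1] := t01.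
  rewrite lee_fin normr1 ger0_norm ?bwt_ge0//.
  have -> : bwt s p.+1 q t = rho s t * t * (t ^+ p * (1 - t) ^+ q).
    by rewrite /bwt exprS; ring.
  apply: mulr_ile1; rewrite ?rho_mul_le1// ?mulr_ge0 ?expR_ge0 ?exprn_ge0 ?subr_ge0//;
    try exact: ltW.
  by rewrite mulr_ile1 ?exprn_ge0 ?exprn_ile1 ?subr_ge0// ?lerBlDr ?lerDl; exact: ltW.
- by apply: (@continuous_integrable_oo _ (cst 1)) => *; exact: cvg_cst.
Qed.

(** For [q >= 1], finiteness is transported by [bet_ibp_ereal] from the bounded weights of
    [integrable_bwtS]; for [q = 0], use [1 = t + (1 - t)]. *)
Lemma integrable_bwt {R : realType} (s : R) (p q : nat) : 0 <= s < 1 ->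
  leb.-integrable `]0, 1[ (EFin \o bwt s p q).
Proof.
move=> s01; have /andP[s0 s1] := s01.
have ps0 : 0 < p.+1%:R - s by rewrite subr_gt0 (lt_le_trans s1)// ler1n.
have iS k : leb.-integrable `]0, 1[ (EFin \o bwt s p k.+1).
  have h : leb.-integrable `]0, 1[ (EFin \o (fun t => (p.+1%:R - s) * bwt s p k.+1 t)).
    apply/integrableP; split.
      apply/measurable_EFinP; apply: measurable_funM => //; exact: measurable_bwt.
    have -> : (\int[leb]_(t in `]0%R, 1%R[) `|((p.+1%:R - s) * bwt s p k.+1 t)%:E|
      = \int[leb]_(t in `]0%R, 1%R[) ((k.+1%:R + s) * bwt s p.+1 k t)%:E)%E.
      rewrite -bet_ibp_ereal//; apply: eq_integral => t.
      rewrite inE/= in_itv/= => t01; rewrite ger0_norm// mulr_ge0 ?bwt_ge0//.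
      exact: ltW.
    by have := integrable_lty _ (integrable_cmul (k.+1%:R + s) (integrable_bwtS p k s01)); apply.
  apply: eq_integrable (integrable_cmul (p.+1%:R - s)^-1 h) => // t _ /=.
  by rewrite mulKf// gt_eqF.
case: q => [|q]; last exact: iS.
have h := integrableD _ (integrable_bwtS p 0 s01) (iS 0%N).
apply: eq_integrable (h _) => // t _ /=.
by rewrite -EFinD /bwt exprS !expr0 expr1; congr EFin; ring.
Qed.

Lemma bet_ibp {R : realType} (s : R) (p q : nat) : 0 <= s < 1 ->
  (p.+1%:R - s) * bet s p q.+1 = (q.+1%:R + s) * bet s p.+1 q.
Proof.
move=> s01; rewrite /bet -!RintegralZl//; try exact: integrable_bwt.
by rewrite /Rintegral bet_ibp_ereal.
Qed.

Lemma bet_split {R : realType} (s : R) (p q : nat) : 0 <= s < 1 ->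
  bet s p q = bet s p.+1 q + bet s p q.+1.
Proof.
move=> s01; rewrite /bet -RintegralD//; try exact: integrable_bwt.
by apply: eq_Rintegral => t _; rewrite /bwt !exprS; ring.
Qed.

Lemma bet_stepl {R : realType} (s : R) (p q : nat) : 0 <= s < 1 ->
  (p%:R + q%:R + 2) * bet s p.+1 q = (p.+1%:R - s) * bet s p q.
Proof.
move=> s01; rewrite (bet_split p q s01) mulrDr (bet_ibp p q s01) -!natr1; ring.
Qed.

Lemma bet_stepr {R : realType} (s : R) (p q : nat) : 0 <= s < 1 ->
  (p%:R + q%:R + 2) * bet s p q.+1 = (q.+1%:R + s) * bet s p q.
Proof.
move=> s01; rewrite (bet_split p q s01) mulrDr -(bet_ibp p q s01) -!natr1; ring.
Qed.

(** One step in each exponent. The dependence of the coefficients on [s] sits in the single factor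
    [(n+1)^2 - s^2], which [cosint_rec] has on the opposite side. *)
Lemma bet_diag {R : realType} (s : R) (n : nat) : 0 <= s < 1 ->
  (n.+1%:R *+ 2) * (n.+1%:R *+ 2 + 1) * bet s n.+1 n.+1
  = (n.+1%:R ^+ 2 - s ^+ 2) * bet s n n.
Proof.
move=> s01; have h1 := bet_stepl n n.+1 s01; have h2 := bet_stepr n n s01.
have -> : n.+1%:R *+ 2 * (n.+1%:R *+ 2 + 1) * bet s n.+1 n.+1
  = n.+1%:R *+ 2 * ((n%:R + n.+1%:R + 2) * bet s n.+1 n.+1).
  by rewrite -!natr1; ring.
rewrite h1.
have -> : n.+1%:R *+ 2 * ((n.+1%:R - s) * bet s n n.+1)
  = (n.+1%:R - s) * ((n%:R + n%:R + 2) * bet s n n.+1).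
  by rewrite -!natr1; ring.
by rewrite h2; ring.
Qed.

Lemma bet00 {R : realType} : bet 0 0 0 = 1 :> R.
Proof.
rewrite /bet (@eq_Rintegral _ _ _ _ _ (cst 1)); last first.
  by move=> t _; rewrite /bwt /rho !expr0 mul0r expR0 !mulr1.
by rewrite Rintegral_cst//= mul1r lebesgue_measure_itv/= lte_fin ltr01 oppr0 adde0.
Qed.

Lemma bet_gt0 {R : realType} (n : nat) : 0 < bet 0 n n :> R.
Proof.
have s01 : 0 <= (0 : R) < 1 by rewrite lexx ltr01.
elim: n => [|n IH]; first by rewrite bet00.
have h := bet_diag n s01.
have c0 : 0 < n.+1%:R *+ 2 * (n.+1%:R *+ 2 + 1) :> R.
  by rewrite mulr_gt0 ?pmulrn_lgt0// addr_gt0// pmulrn_lgt0.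
by rewrite -(pmulr_rgt0 _ c0) h expr0n subr0 mulr_gt0// exprn_gt0.
Qed.

Lemma rho_upper {R : realType} (s t : R) : 0 <= s <= 1 -> 0 < t < 1 ->
  rho s t <= 1 - s + s * ((1 - t) / t).
Proof.
move=> /andP[s0 s1] t01; have r0 := ratio_gt0 t01; have /andP[t0 _] := t01.
have -> : (1 - t) / t = expR (ln (1 / t - 1)).
  by rewrite lnK ?posrE//; field; rewrite gt_eqF.
rewrite /rho; set l := ln _.
(* tangent lines of exp at [s * l], evaluated at [l] and at [0] *)
have h1 : expR (s * l) * (1 + (1 - s) * l) <= expR l.
  have -> : expR l = expR (s * l) * expR ((1 - s) * l).
    by rewrite -expRD; congr expR; ring.
  by rewrite ler_wpM2l ?expR_ge0// expR_ge1Dx.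
have h2 : expR (s * l) * (1 - s * l) <= 1.
  rewrite -[leRHS](_ : expR (s * l) * expR (- (s * l)) = 1); last first.
    by rewrite -expRD subrr expR0.
  by rewrite ler_wpM2l ?expR_ge0// expR_ge1Dx.
(* In this convex combination of [h1] and [h2] the terms linear in [l] cancel. *)
have -> : expR (s * l) = (1 - s) * (expR (s * l) * (1 - s * l))
  + s * (expR (s * l) * (1 + (1 - s) * l)) by ring.
apply: lerD; last exact: ler_wpM2l.
by rewrite -[leRHS]mulr1 ler_wpM2l// subr_ge0.
Qed.

(** Two uses of [exp y >= 1 + y]: first [rho s t >= 1 + s l] with [l = ln (1 / t - 1)], then
    [l >= 1 - exp(- l)]. *)
Lemma rho_lower {R : realType} (s t : R) : 0 <= s -> 0 < t < 1 ->
  1 + s * (1 - t / (1 - t)) <= rho s t.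
Proof.
move=> s0 t01; have r0 := ratio_gt0 t01; have /andP[t0 t1] := t01.
have u0 : 1 - t != 0 by rewrite subr_eq0 gt_eqF.
apply: le_trans (expR_ge1Dx _); rewrite lerD2l ler_wpM2l//.
have -> : t / (1 - t) = expR (- ln (1 / t - 1)).
  rewrite expRN lnK ?posrE//; by field; rewrite mulN1r u0 gt_eqF.
by have := expR_ge1Dx (- ln (1 / t - 1)); lra.
Qed.

(** [rho_lower] and [rho_upper] are integrated against [(t (1 - t))^(n+1)]. The ratios [t / (1 - t)]
    and [(1 - t) / t] merely shift the exponents, and at [s = 0] the shifted integrals are explicit
    multiples of the central one. *)
Lemma bet_bounds {R : realType} (s : R) (n : nat) : 0 <= s < 1 ->
  (1 - s / n.+1%:R) * bet 0 n.+1 n.+1 <= bet s n.+1 n.+1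
    <= (1 + s / n.+1%:R) * bet 0 n.+1 n.+1.
Proof.
move=> s01; have /andP[s0 s1] := s01.
have z01 : 0 <= (0 : R) < 1 by rewrite lexx ltr01.
have N0 : n.+1%:R != 0 :> R by rewrite pnatr_eq0.
have rho0 t : rho 0 t = 1 :> R by rewrite /rho mul0r expR0.
have h1 : bet 0 n n.+2 = n.+2%:R / n.+1%:R * bet 0 n.+1 n.+1 :> R.
  have := @bet_ibp R 0 n n.+1 z01; rewrite subr0 addr0 => h.
  by apply: (mulfI N0); rewrite h; field.
have h2 : bet 0 n.+2 n = n.+2%:R / n.+1%:R * bet 0 n.+1 n.+1 :> R.
  have := @bet_ibp R 0 n.+1 n z01; rewrite subr0 addr0 => h.
  by apply: (mulfI N0); rewrite -h; field.
apply/andP; split.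
- have -> : (1 - s / n.+1%:R) * bet 0 n.+1 n.+1
    = \int[leb]_(t in `]0, 1[) ((1 + s) * bwt 0 n.+1 n.+1 t - s * bwt 0 n.+2 n t).
    rewrite RintegralB ?RintegralZl//; try exact: integrable_bwt;
      try (apply: integrable_cmul; exact: integrable_bwt).
    by rewrite -!/(bet _ _ _) h2 -natr1; field.
  apply: le_Rintegral => //.
  + by apply: (integrableB _ (integrable_cmul (1 + s) (integrable_bwt n.+1 n.+1 z01))
      (integrable_cmul s (integrable_bwt n.+2 n z01))).
  + exact: integrable_bwt.
  + move=> t; rewrite /= in_itv/= => t01; have /andP[t0 t1] := t01.
    have u0 : 1 - t != 0 by rewrite subr_eq0 gt_eqF.
    have -> : (1 + s) * bwt 0 n.+1 n.+1 t - s * bwt 0 n.+2 n t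
      = (1 + s * (1 - t / (1 - t))) * (t ^+ n.+1 * (1 - t) ^+ n.+1).
      by rewrite /bwt rho0 !exprS; field.
    have := bwt_ge0 0 n.+1 n.+1 t01; rewrite /bwt rho0 mul1r => w0.
    by rewrite ler_wpM2r// rho_lower.
- have -> : (1 + s / n.+1%:R) * bet 0 n.+1 n.+1
    = \int[leb]_(t in `]0, 1[) ((1 - s) * bwt 0 n.+1 n.+1 t + s * bwt 0 n n.+2 t).
    rewrite RintegralD ?RintegralZl//; try exact: integrable_bwt;
      try (apply: integrable_cmul; exact: integrable_bwt).
    by rewrite -!/(bet _ _ _) h1 -natr1; field.
  apply: le_Rintegral => //.
  + exact: integrable_bwt.
  + by apply: (integrableD _ (integrable_cmul (1 - s) (integrable_bwt n.+1 n.+1 z01))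
      (integrable_cmul s (integrable_bwt n n.+2 z01))).
  + move=> t; rewrite /= in_itv/= => t01; have /andP[t0 t1] := t01.
    have -> : (1 - s) * bwt 0 n.+1 n.+1 t + s * bwt 0 n n.+2 t
      = (1 - s + s * ((1 - t) / t)) * (t ^+ n.+1 * (1 - t) ^+ n.+1).
      by rewrite /bwt rho0 !exprS; field; rewrite gt_eqF.
    have := bwt_ge0 0 n.+1 n.+1 t01; rewrite /bwt rho0 mul1r => w0.
    by rewrite ler_wpM2r// rho_upper// s0 ltW.
Qed.

(** * Euler's reflection formula *)

Definition cosint {R : realType} (s : R) (n : nat) : R :=
  \int[leb]_(x in `]0, pi / 2[) (cos x ^+ n.*2 * cos (2 * s * x)).

Lemma continuous_cosint {R : realType} (s : R) (n : nat) (x : R) :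
  {for x, continuous (fun x => cos x ^+ n * cos (2 * s * x))}.
Proof.
apply: continuousM; last exact: is_derive1_continuous (is_derive_cosM _ _).
exact: is_derive1_continuous (is_derive1X n (is_derive_cos x)).
Qed.

Lemma integrable_cosint {R : realType} (s : R) (n : nat) :
  leb.-integrable `]0, pi / 2[ (EFin \o (fun x : R => cos x ^+ n * cos (2 * s * x))).
Proof. by apply: continuous_integrable_oo => x _; exact: continuous_cosint. Qed.

Lemma cosint_rec {R : realType} (s : R) (n : nat) :
  (n.+1%:R ^+ 2 - s ^+ 2) * cosint s n.+1 *+ 4
  = (n.+1%:R *+ 2) * (n.+1%:R *+ 2 - 1) * cosint s n.
Proof.
set c := 2 * s; set m : R := n.+1%:R *+ 2.
have p2 : 0 < pi / 2 :> R by rewrite divr_gt0// pi_gt0.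
(* [F] is an antiderivative of [f]. It vanishes at [pi / 2] through the power of the cosine and at 0
   through the sines, so [f] has integral 0. *)
pose F (x : R) := cos x ^+ n.*2.+1 * (m * (sin x * cos (c * x)) - c * (cos x * sin (c * x))).
pose f (x : R) := (m ^+ 2 - c ^+ 2) * (cos x ^+ n.+1.*2 * cos (c * x))
  - m * (m - 1) * (cos x ^+ n.*2 * cos (c * x)).
have cf (x : R) : 0 <= x <= pi / 2 -> {for x, continuous f}.
  move=> _; apply: continuousB; apply: continuousM; try exact: cvg_cst;
    exact: continuous_cosint.
have dF (x : R) : 0 <= x <= pi / 2 -> is_derive x 1 F (f x).
  move=> _.
  have d1 := is_derive1_cmul m (is_derive1M (is_derive_sin x) (is_derive_cosM c x)).
  have d2 := is_derive1_cmul c (is_derive1M (is_derive_cos x) (is_derive_sinM c x)).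
  apply: (is_derive_eq (is_derive1M (is_derive1X n.*2.+1 (is_derive_cos x)) (is_derive1B d1 d2))).
  rewrite /f doubleS /= !exprS.
  have -> : n.*2.+1%:R = m - 1 :> R by rewrite /m -!natr1 -mul2n natrM; ring.
  have s2 : sin x * sin x = 1 - cos x ^+ 2 by rewrite -expr2 sin2cos2.
  set S := sin x in s2 *; set C := cos x in s2 *.
  set Sc := sin _; set Cc := cos _; set P := C ^+ n.*2.
  transitivity ((m - 1) * P * m * Cc * (- (S * S)) + C * C * P * Cc * (m - c ^+ 2)).
    by ring.
  by rewrite s2; ring.
have := ftc_oo p2 cf dF.
have -> : F (pi / 2) = 0 by rewrite /F cos_pihalf expr0n mul0r.
have -> : F 0 = 0 by rewrite /F mulr0 sin0 mul0r !mulr0 subrr mulr0.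
rewrite subrr.
rewrite /f RintegralB//; last 2 first.
- by apply: integrable_cmul; exact: integrable_cosint.
- by apply: integrable_cmul; exact: integrable_cosint.
rewrite !RintegralZl//; try exact: integrable_cosint.
rewrite -!/(cosint _ _) => /eqP; rewrite subr_eq0 => /eqP <-.
by rewrite /m /c; ring.
Qed.

Lemma cosint0 {R : realType} (s : R) : 2 * s * cosint s 0 = sin (pi * s).
Proof.
have p2 : 0 < pi / 2 :> R by rewrite divr_gt0// pi_gt0.
rewrite -RintegralZl//; last exact: integrable_cosint.
have cf (x : R) : 0 <= x <= pi / 2 ->
    {for x, continuous (fun x => 2 * s * (cos x ^+ 0.*2 * cos (2 * s * x)))}.
  by move=> _; apply: continuousM; [exact: cvg_cst | exact: continuous_cosint].
have dF (x : R) : 0 <= x <= pi / 2 -> is_derive x 1 (fun x => sin (2 * s * x))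
    (2 * s * (cos x ^+ 0.*2 * cos (2 * s * x))).
  by move=> _; rewrite expr0 mul1r; exact: is_derive_sinM.
rewrite (ftc_oo p2 cf dF) mulr0 sin0 subr0; congr sin.
by field.
Qed.

Lemma cosint00 {R : realType} : cosint 0 0 = pi / 2 :> R.
Proof.
have p2 : 0 < pi / 2 :> R by rewrite divr_gt0// pi_gt0.
rewrite /cosint (@eq_Rintegral _ _ _ _ _ (cst 1)); last first.
  by move=> t _; rewrite expr0 mulr0 mul0r cos0 mulr1.
by rewrite Rintegral_cst//= mul1r lebesgue_measure_itv/= lte_fin p2 oppr0 adde0.
Qed.

Lemma cosint_gt0 {R : realType} (n : nat) : 0 < cosint 0 n :> R.
Proof.
elim: n => [|n IH]; first by rewrite cosint00 divr_gt0// pi_gt0.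
have := @cosint_rec R 0 n; rewrite expr0n subr0 => h.
have n1 : 1 <= n.+1%:R :> R by rewrite ler1n.
have c0 : 0 < n.+1%:R ^+ 2 *+ 4 :> R by rewrite pmulrn_lgt0// exprn_gt0.
rewrite -(pmulr_rgt0 _ c0) -mulrnAl in h *.
rewrite h mulr_gt0// mulr_gt0 ?pmulrn_lgt0// subr_gt0 mulr2n; lra.
Qed.

(** Below, [cos (2 s x) >= cos (2 x) = 2 cos(x)^2 - 1], whose weighted integral is explicit by
    [cosint_rec] at [s = 0]; above, the cosine is at most 1. *)
Lemma cosint_bounds {R : realType} (s : R) (n : nat) : 0 <= s <= 1 ->
  (1 - n.+1%:R^-1) * cosint 0 n <= cosint s n <= cosint 0 n.
Proof.
move=> /andP[s0 s1].
have p2 : 0 < pi / 2 :> R by rewrite divr_gt0// pi_gt0.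
have C0 x : 0 < x < pi / 2 -> 0 <= cos x ^+ n.*2 :> R.
  by move=> _; rewrite exprn_even_ge0// odd_double.
have cos0x (x : R) : cos (2 * 0 * x) = 1 by rewrite mulr0 mul0r cos0.
have h : (1 - n.+1%:R^-1) * cosint 0 n
  = \int[leb]_(x in `]0, pi / 2[)
      (2 * (cos x ^+ n.+1.*2 * cos (2 * 0 * x)) - cos x ^+ n.*2 * cos (2 * 0 * x)) :> R.
  rewrite RintegralB ?RintegralZl//; try exact: integrable_cosint; last first.
    by apply: integrable_cmul; exact: integrable_cosint.
  rewrite -!/(cosint _ _).
  have := @cosint_rec R 0 n; rewrite expr0n subr0 => h.
  have n0 : n.+1%:R != 0 :> R by rewrite pnatr_eq0.
  have -> : cosint 0 n.+1 = (n.+1%:R *+ 2 - 1) / (n.+1%:R *+ 2) * cosint 0 n :> R.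
    have c0 : n.+1%:R ^+ 2 * 4 != 0 :> R by rewrite mulf_neq0 ?expf_neq0.
    apply: (mulfI c0); rewrite -[LHS](_ : n.+1%:R ^+ 2 * cosint 0 n.+1 *+ 4 = _); last by ring.
    by rewrite h; field.
  by field.
apply/andP; split.
- rewrite h; apply: le_Rintegral => //; try exact: integrable_cosint.
    by apply: (integrableB _ (integrable_cmul 2 (integrable_cosint 0 n.+1.*2))
      (integrable_cosint 0 n.*2)).
  move=> x; rewrite /= in_itv/= => /andP[x0 xp]; rewrite !cos0x doubleS !exprS !mulr1.
  have -> : 2 * (cos x * (cos x * cos x ^+ n.*2)) - cos x ^+ n.*2
    = cos x ^+ n.*2 * (2 * cos x ^+ 2 - 1) by ring.
  apply: ler_wpM2l; first by apply: C0; rewrite x0.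
  (* Passing to squared sines of [s x] and [x] requires monotonicity of the sine on [[0, pi / 2]]
     only. *)
  have -> : cos (2 * s * x) = 1 - 2 * sin (s * x) ^+ 2.
    by rewrite -mulrA mulr_natl cos_mulr2n cos2sin2; ring.
  rewrite cos2sin2.
  have sx : s * x <= x by rewrite ler_piMl// ltW.
  have sx0 : 0 <= s * x by rewrite mulr_ge0// ltW.
  have q0 : - (pi / 2) <= 0 :> R by rewrite oppr_le0 ltW.
  have ss : sin (s * x) <= sin x.
    have := @ltr_sin R; rewrite /prop_in2 => sin_mono.
    rewrite le_eqVlt in sx; case/predU1P: sx => [->//|sx].
    apply/ltW; rewrite sin_mono// ?in_itv/=; lra.
  have sn0 : 0 <= sin (s * x).
    by apply: sin_ge0_pi; rewrite sx0/=; have := pi_gt0 R; lra.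
  have : sin (s * x) ^+ 2 <= sin x ^+ 2 by rewrite ler_sqr// nnegrE// (le_trans sn0).
  by lra.
- apply: le_Rintegral => //; try exact: integrable_cosint.
  move=> x; rewrite /= in_itv/= => x01; rewrite cos0x mulr1.
  by rewrite ler_piMr ?C0// cos_le1.
Qed.

Lemma le0_of_le_inv {R : realType} (a c : R) :
  0 < c -> (forall m : nat, a <= c / m.+1%:R) -> a <= 0.
Proof.
move=> c0 h; rewrite leNgt; apply/negP => a0.
have := archi_boundP (ltW (divr_gt0 c0 a0)); rewrite ltr_pdivrMr// => hb.
have := h (Num.bound (c / a)); rewrite ler_pdivlMr// -natr1; nra.
Qed.

(** The factors [(n+1)^2 - s^2] of [cosint_rec] and [bet_diag] cancel, leaving coefficients free of
    [s]. *)
Lemma cosint_bet_rec {R : realType} (s : R) (n : nat) : 0 <= s < 1 ->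
  4 * (n.+1%:R *+ 2 + 1) * (cosint s n.+1 * bet s n.+1 n.+1)
  = (n.+1%:R *+ 2 - 1) * (cosint s n * bet s n n).
Proof.
move=> s01; have /andP[s0 s1] := s01.
have h1 := cosint_rec s n; have h2 := bet_diag n s01.
have n1 : 1 <= n.+1%:R :> R by rewrite ler1n.
have D0 : n.+1%:R ^+ 2 - s ^+ 2 != 0 by rewrite gt_eqF// subr_gt0; nra.
have N0 : n.+1%:R *+ 2 != 0 :> R by rewrite gt_eqF// pmulrn_lgt0.
apply: (mulfI (mulf_neq0 D0 N0)).
move: h1 h2; set X := cosint s n.+1; set Y := bet s n.+1 n.+1; set N := n.+1%:R.
set D := N ^+ 2 - s ^+ 2 => h1 h2.
transitivity ((D * X *+ 4) * ((N *+ 2) * (N *+ 2 + 1) * Y)); first by ring.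
by rewrite h1 h2; ring.
Qed.

Lemma mul_near_one {R : realType} (i A B a b : R) :
  0 < i -> i <= 1 -> 0 < A -> 0 < B ->
  (1 - i) * A <= a <= A -> (1 - i) * B <= b <= (1 + i) * B ->
  (1 - 2 * i) * (A * B) <= a * b <= (1 + 2 * i) * (A * B).
Proof.
move=> i0 i1 A0 B0 /andP[a1 a2] /andP[b1 b2].
have u0 : 0 <= 1 - i by rewrite subr_ge0.
have A1 : 0 <= (1 - i) * A by rewrite mulr_ge0// ltW.
have B1 : 0 <= (1 - i) * B by rewrite mulr_ge0// ltW.
have AB : 0 <= A * B by rewrite mulr_ge0// ltW.
apply/andP; split.
  apply: (@le_trans _ _ ((1 - i) * A * ((1 - i) * B))); last exact: ler_pM.
  rewrite mulrACA; apply: ler_wpM2r => //.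
  by have := mulr_ge0 (ltW i0) (ltW i0); lra.
apply: (@le_trans _ _ (A * ((1 + i) * B))).
  by apply: ler_pM => //; [exact: le_trans a1 | exact: le_trans b1].
by rewrite mulrCA; apply: ler_wpM2r => //; lra.
Qed.

Lemma bet_reflection {R : realType} (s : R) : 0 < s < 1 ->
  sin (pi * s) * bet s 0 0 = pi * s.
Proof.
move=> /andP[s0 s1]; have s01 : 0 <= s < 1 by rewrite ltW.
have z01 : 0 <= (0 : R) < 1 by rewrite lexx ltr01.
pose X n := cosint s n * bet s n n; pose Y n : R := cosint 0 n * bet 0 n n.
have Y0 n : 0 < Y n by rewrite mulr_gt0 ?cosint_gt0 ?bet_gt0.
(* [X] and [Y] satisfy the same recurrence, so [X n / Y n] is constant in [n]. *)
have XY n : X n * Y 0%N = Y n * X 0%N.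
  elim: n => [|n IH]; first by rewrite mulrC.
  have c0 : 4 * (n.+1%:R *+ 2 + 1) != 0 :> R.
    by rewrite gt_eqF// mulr_gt0// addr_gt0// pmulrn_lgt0.
  have h1 : _ * X n.+1 = _ * X n := cosint_bet_rec n s01.
  have h2 : _ * Y n.+1 = _ * Y n := cosint_bet_rec n z01.
  apply: (mulfI c0); rewrite mulrA h1 -[LHS]mulrA IH [LHS]mulrA -h2.
  by rewrite -[LHS]mulrA.
pose x := X 0%N / Y 0%N.
have Xx n : X n = x * Y n.
  by rewrite /x mulrAC [X 0%N * _]mulrC -XY mulfK// gt_eqF.
(* Evaluating the constant ratio at index [m.+1] puts it within [2 / (m+1)] of 1, for every [m]. *)
have bnd m : x - 1 <= 2 / m.+1%:R /\ 1 - x <= 2 / m.+1%:R.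
  have i0 : 0 < m.+1%:R^-1 :> R by rewrite invr_gt0.
  have i1 : m.+1%:R^-1 <= 1 :> R by rewrite invf_le1// ler1n.
  have j1 : m.+2%:R^-1 <= m.+1%:R^-1 :> R by rewrite lef_pV2 ?posrE// ler_nat.
  have near1 := @mul_near_one R m.+1%:R^-1 _ _ (cosint s m.+1) (bet s m.+1 m.+1)
    i0 i1 (@cosint_gt0 R m.+1) (@bet_gt0 R m.+1).
  have /andP[b1 b2] := bet_bounds m s01.
  have /andP[c1 c2] := @cosint_bounds _ s m.+1 (introT andP (conj (ltW s0) (ltW s1))).
  have si : s / m.+1%:R <= m.+1%:R^-1 by rewrite ler_piMl// ltW.
  have /andP[e1 e2] : (1 - 2 / m.+1%:R) * Y m.+1 <= X m.+1 <= (1 + 2 / m.+1%:R) * Y m.+1.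
    apply: near1; rewrite ?c2 ?andbT.
    - by apply: le_trans c1; rewrite ler_wpM2r ?lerD2l ?lerN2// ltW// cosint_gt0.
    - apply/andP; split.
        by apply: le_trans b1; rewrite ler_wpM2r ?lerD2l ?lerN2// ltW// bet_gt0.
      apply: le_trans b2 _; apply: ler_wpM2r; first exact/ltW/bet_gt0.
      by rewrite lerD2l.
  rewrite Xx ler_pM2r// in e1; rewrite Xx ler_pM2r// in e2.
  by split; [rewrite lerBlDl | rewrite lerBlDr -lerBlDl].
have x1 : x = 1.
  apply/eqP; rewrite eq_le; apply/andP; split; rewrite -subr_le0.
    by apply: (@le0_of_le_inv _ _ 2) => // m; have [] := bnd m.
  by apply: (@le0_of_le_inv _ _ 2) => // m; have [] := bnd m.
(* At index 0 this reads [cosint s 0 * bet s 0 0 = pi / 2], and [cosint0] brings in the sine. *)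
have : X 0%N = Y 0%N by rewrite Xx x1 mul1r.
rewrite /X /Y cosint00 bet00 mulr1 => h.
by rewrite -cosint0 -mulrA h; field.
Qed.

(** * Series for gamma *)

(* [bet s k 0 / bet s 0 0]. *)
Definition mom_prod {R : realType} (k : nat) (s : R) : R :=
  \prod_(0 <= i < k) ((i.+1%:R - s) / i.+2%:R).

Lemma mom_prodS {R : realType} (k : nat) (s : R) :
  k.+2%:R * mom_prod k.+1 s = (k.+1%:R - s) * mom_prod k s.
Proof.
by rewrite /mom_prod big_nat_recr//= mulrCA mulrC; field; rewrite -?natr1 ?pnatr_eq0.
Qed.

Lemma mom_prod_bounds {R : realType} (k : nat) (s : R) : 0 <= s <= 1 ->
  0 <= mom_prod k s <= k.+1%:R^-1.
Proof.
move=> /andP[s0 s1]; elim: k => [|k IH].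
  by rewrite /mom_prod big_geq// invr1 ler01 lexx.
have /andP[h0 h1] := IH; have := mom_prodS k s => h.
have k1 : 1 <= k.+1%:R :> R by rewrite ler1n.
have k2 : 0 < k.+2%:R :> R by [].
rewrite -(pmulr_rge0 _ k2) h mulr_ge0 ?subr_ge0 ?(le_trans s1)//=.
rewrite -(ler_pM2l k2) h divff ?gt_eqF//.
rewrite -[leRHS](@mulfV _ k.+1%:R) ?pnatr_eq0//.
apply: ler_pM => //; first by rewrite subr_ge0 (le_trans s1).
by rewrite lerBlDr lerDl.
Qed.

Lemma continuous_mom_prod {R : realType} (k : nat) (s : R) :
  {for s, continuous (fun s : R => mom_prod k s)}.
Proof.
elim: k => [|k IH].
  have -> : (fun s : R => mom_prod 0 s) = cst 1.
    by apply/funext => x; rewrite /mom_prod big_geq.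
  exact: cvg_cst.
have -> : (fun s : R => mom_prod k.+1 s)
  = (fun s => mom_prod k s * ((k.+1%:R - s) * k.+2%:R^-1)).
  by apply/funext => x; rewrite /mom_prod big_nat_recr.
apply: continuousM; first exact: IH.
apply: continuousM; last exact: cvg_cst.
by apply: continuousB; [exact: cvg_cst | exact: cvg_id].
Qed.

(** The absolute value of the Gregory coefficient of index [k + 1] (1/2, 1/12, 1/24, ...);
    [omega_moment] identifies it with the k-th moment of [omega]. *)
Definition moment {R : realType} (k : nat) : R :=
  \int[leb]_(s in `]0, 1[) (s * mom_prod k s).

Lemma continuous_mom {R : realType} (k : nat) (s : R) :
  {for s, continuous (fun s : R => s * mom_prod k s)}.
Proof. apply: continuousM; [exact: cvg_id | exact: continuous_mom_prod]. Qed.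

Lemma integrable_mom {R : realType} (k : nat) :
  leb.-integrable `]0, 1[ (EFin \o (fun s : R => s * mom_prod k s)).
Proof. by apply: continuous_integrable_oo => s _; exact: continuous_mom. Qed.

Lemma bet_mom {R : realType} (s : R) (k : nat) : 0 <= s < 1 ->
  bet s k 0 = bet s 0 0 * mom_prod k s.
Proof.
move=> s01; elim: k => [|k IH]; first by rewrite /mom_prod big_geq// mulr1.
have k2 : k.+2%:R != 0 :> R by rewrite pnatr_eq0.
apply: (mulfI k2); rewrite mulrCA mom_prodS.
have := bet_stepl k 0 s01; rewrite addr0.
have -> : k%:R + 2 = k.+2%:R :> R by rewrite -!natr1; ring.
by move=> ->; rewrite IH; ring.
Qed.

Lemma sin_bet_mom {R : realType} (s : R) (k : nat) : 0 < s < 1 ->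
  sin (pi * s) * bet s k 0 = pi * (s * mom_prod k s).
Proof.
move=> s01; rewrite bet_mom; last by have /andP[a ->] := s01; rewrite ltW.
by rewrite mulrA bet_reflection// mulrA.
Qed.

(** [bet0 n k] is [n! k! / (n + k + 1)!]. *)
Notation bet0 := (bet 0).

Lemma zero01 {R : realType} : 0 <= (0 : R) < 1.
Proof. by rewrite lexx ltr01. Qed.

Lemma bet0S {R : realType} (n k : nat) :
  (n + k).+2%:R * bet0 n k.+1 = k.+1%:R * bet0 n k :> R.
Proof.
have := @bet_stepr R 0 n k zero01; rewrite addr0 => <-.
by congr (_ * _); rewrite -!natr1 natrD; ring.
Qed.

Lemma bet0n0 {R : realType} (n : nat) : bet0 n 0 = n.+1%:R^-1 :> R.
Proof.
elim: n => [|n IH]; first by rewrite bet00 invr1.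
have n2 : n.+2%:R != 0 :> R by rewrite pnatr_eq0.
apply: (mulfI n2); rewrite divff//.
have := @bet_stepl R 0 n 0 zero01; rewrite subr0 addr0 IH.
have -> : n%:R + 2 = n.+2%:R :> R by rewrite -!natr1; ring.
by move=> ->; rewrite divff// pnatr_eq0.
Qed.

Lemma bet_ge0 {R : realType} (s : R) (p q : nat) : 0 <= bet s p q.
Proof. by apply: Rintegral_ge0 => t /=; rewrite in_itv/=; exact: bwt_ge0. Qed.

Lemma bet0_le {R : realType} (n k : nat) :
  bet0 n k <= n.+1%:R^-1 / k.+1%:R :> R.
Proof.
elim: k => [|k IH]; first by rewrite bet0n0 invr1 mulr1.
have k2 : 0 < (n + k).+2%:R :> R by [].
rewrite -(ler_pM2l k2) bet0S.
apply: (@le_trans _ _ n.+1%:R^-1).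
  by rewrite mulrC -ler_pdivlMr.
rewrite mulrCA ler_peMr ?invr_ge0// ler_pdivlMr// mul1r ler_nat.
by rewrite ltnS ltnS leq_addl.
Qed.

Lemma moment_bounds {R : realType} (k : nat) :
  0 <= (moment k : R) <= k.+1%:R^-1.
Proof.
apply/andP; split.
  apply: Rintegral_ge0 => s; rewrite /= in_itv/= => /andP[s0 s1].
  have /andP[h _] : 0 <= mom_prod k s <= k.+1%:R^-1 by apply: mom_prod_bounds; rewrite !ltW.
  by rewrite mulr_ge0// ltW.
have -> : k.+1%:R^-1 = \int[leb]_(s in `]0, 1[) (cst k.+1%:R^-1 s) :> R.
  by rewrite Rintegral_cst//= lebesgue_measure_itv/= lte_fin ltr01 oppr0 adde0 mulr1.
apply: le_Rintegral => //; first exact: integrable_mom.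
  by apply: continuous_integrable_oo => *; exact: cvg_cst.
move=> s; rewrite /= in_itv/= => /andP[s0 s1].
have /andP[h0 h] : 0 <= mom_prod k s <= k.+1%:R^-1 by apply: mom_prod_bounds; rewrite !ltW.
by apply: le_trans h; rewrite ler_piMl// ltW.
Qed.

Lemma sum_inv_sq {R : realType} (K : nat) :
  \sum_(0 <= k < K) (k.+1%:R^-1 / k.+1%:R) <= 2 - K%:R^-1 :> R.
Proof.
elim: K => [|K IH]; first by rewrite big_geq// invr0 subr0.
rewrite big_nat_recr//=.
(* The bound at [K = 0] rests on [0^-1 = 0], so the passage from 0 to 1 is checked apart. *)
case: K IH => [|K] IH; first by rewrite big_geq// invr1; lra.
apply: le_trans (lerD IH (lexx _)) _.
have K1 : 1 <= K.+1%:R :> R by rewrite ler1n.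
have -> : K.+2%:R = K.+1%:R + 1 :> R by rewrite natr1.
move: K1; move: (K.+1%:R : R) => x K1.
have x0 : x != 0 by rewrite gt_eqF// (lt_le_trans ltr01).
have x1 : x + 1 != 0 by rewrite gt_eqF// ltr_wpDl// (le_trans ler01).
rewrite -subr_ge0.
have -> : 2 - (x + 1)^-1 - (2 - x^-1 + (x + 1)^-1 / (x + 1)) = (x * (x + 1) ^+ 2)^-1.
  by field; rewrite x0 x1.
by rewrite invr_ge0 mulr_ge0 ?sqr_ge0// (le_trans ler01).
Qed.

(* Partial sums of the series of gamma - S_n. *)
Definition tail_psum {R : realType} (n K : nat) : R :=
  \sum_(0 <= k < K) bet0 n k * moment k.

Lemma tail_psum_le {R : realType} (n K : nat) : tail_psum n K <= 2 / n.+1%:R :> R.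
Proof.
apply: (@le_trans _ _ (n.+1%:R^-1 * \sum_(0 <= k < K) (k.+1%:R^-1 / k.+1%:R))).
  rewrite mulr_sumr; apply: ler_sum => k _.
  have /andP[m0 m1] := @moment_bounds R k.
  by rewrite mulrCA mulrC; apply: ler_pM => //; [exact: bet_ge0 | exact: bet0_le].
rewrite [leRHS]mulrC ler_wpM2l ?invr_ge0//; apply: le_trans (sum_inv_sq K) _.
by rewrite lerBlDr lerDl invr_ge0.
Qed.

Lemma nondecreasing_tail_psum {R : realType} (n : nat) : nondecreasing_seq (@tail_psum R n).
Proof.
apply/nondecreasing_seqP => K; rewrite /tail_psum big_nat_recr//= lerDl mulr_ge0 ?bet_ge0//.
by have /andP[] := @moment_bounds R K.
Qed.

Lemma is_cvg_tail_psum {R : realType} (n : nat) : cvgn (@tail_psum R n).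
Proof.
apply: nondecreasing_is_cvgn; first exact: nondecreasing_tail_psum.
by exists (2 / n.+1%:R) => _ [K _ <-]; exact: tail_psum_le.
Qed.

(** Telescoping: multiplied by [(n+1) (n+1+s)], the k-th summand is the difference of the values at
    [k] and [k + 1] of [(k+1) (n+1) bet0 n k * mom_prod k s], which starts at 1. *)
Lemma sum_mom_prod {R : realType} (n K : nat) (s : R) : 0 <= s ->
  \sum_(0 <= k < K) bet0 n k.+1 * mom_prod k s
  = (1 - n.+1%:R * K.+1%:R * bet0 n K * mom_prod K s) / (n.+1%:R * (n.+1%:R + s)).
Proof.
move=> s0.
have n0 : n.+1%:R != 0 :> R by rewrite pnatr_eq0.
have ns0 : n.+1%:R + s != 0 by rewrite gt_eqF// ltr_wpDr.
have D0 := mulf_neq0 n0 ns0; apply: (mulIf D0); rewrite divfK//.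
elim: K => [|K IH].
  by rewrite big_geq// mul0r bet0n0 /mom_prod big_geq// !mulr1 divff// subrr.
rewrite big_nat_recr//= mulrDl IH.
have h1 := @bet0S R n K; have h2 := mom_prodS K s.
have -> : n.+1%:R * K.+2%:R * bet0 n K.+1 * mom_prod K.+1 s
   = n.+1%:R * bet0 n K.+1 * (K.+2%:R * mom_prod K.+1 s) by ring.
have -> : n.+1%:R * K.+1%:R * bet0 n K * mom_prod K s
   = n.+1%:R * (K.+1%:R * bet0 n K) * mom_prod K s by ring.
by rewrite -h1 h2 -!natr1 natrD; ring.
Qed.

(** Partial fractions: with [a = n + 1] the integrand is [1 / a - 1 / (a + s)]. *)
Lemma Rintegral_euler_S_step {R : realType} (n : nat) :
  \int[leb]_(s in `]0, 1[) (s * (n.+1%:R * (n.+1%:R + s))^-1)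
  = euler_S R n.+1 - euler_S R n.
Proof.
set a : R := n.+1%:R; have a0 : 0 < a by [].
have as0 (s : R) : 0 <= s <= 1 -> 0 < a + s by case/andP => s0 _; rewrite ltr_wpDr.
have dF (s : R) : 0 <= s <= 1 -> is_derive s 1
    (fun s => s * a^-1 - ln (a + s)) (s * (a * (a + s))^-1).
  move=> s01; have h := as0 _ s01.
  have d1 : is_derive s 1 (fun y => a + y) 1.
    by apply: (is_derive_eq (is_deriveD (is_derive_cst a s 1) (is_derive_id s 1))); rewrite add0r.
  have d2 := is_derive1_lnf h d1.
  apply: (is_derive_eq (is_derive1B (is_derive1_mulc a^-1 (is_derive_id s 1)) d2)).
  by move: a0 h; move: (a) => b b0 h; field; rewrite !gt_eqF.
have cf (s : R) : 0 <= s <= 1 -> {for s, continuous (fun s : R => s * (a * (a + s))^-1)}.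
  move=> s01; have h := as0 _ s01.
  apply: continuousM; first exact: cvg_id.
  apply: continuousV; first by rewrite gt_eqF// mulr_gt0.
  apply: continuousM; first exact: cvg_cst.
  by apply: continuousD; [exact: cvg_cst | exact: cvg_id].
rewrite (ftc_oo ltr01 cf dF) mul0r addr0 mul1r /euler_S [in RHS]big_nat_recr//=.
have -> : a + 1 = n.+2%:R by rewrite natr1.
rewrite -/a; ring.
Qed.

Lemma integrable_sum_mom {R : realType} (n K : nat) :
  leb.-integrable `]0, 1[ (EFin \o (fun s : R =>
    s * (\sum_(0 <= k < K) bet0 n k.+1 * mom_prod k s))).
Proof.
have cS (s : R) : {for s, continuous (fun s : R =>
    \sum_(0 <= k < K) bet0 n k.+1 * mom_prod k s)}.
  elim: K => [|K IH].
    have -> : (fun s : R => \sum_(0 <= k < 0) bet0 n k.+1 * mom_prod k s) = cst 0.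
      by apply/funext => x; rewrite big_geq.
    exact: cvg_cst.
  have -> : (fun s : R => \sum_(0 <= k < K.+1) bet0 n k.+1 * mom_prod k s)
    = (fun s => \sum_(0 <= k < K) bet0 n k.+1 * mom_prod k s + bet0 n K.+1 * mom_prod K s).
    by apply/funext => x; rewrite big_nat_recr.
  apply: continuousD; first exact: IH.
  by apply: continuousM; [exact: cvg_cst | exact: continuous_mom_prod].
apply: continuous_integrable_oo => s _; apply: continuousM; first exact: cvg_id.
exact: cS.
Qed.

(** Since [bet0 n k - bet0 n.+1 k = bet0 n k.+1], the difference of partial sums is the integral of
    [s] times the telescoping sum of [sum_mom_prod], whose relative defect lies between 0 and
    [1 / (K+1)]. *)
Lemma tail_psum_step {R : realType} (n K : nat) :
  (1 - K.+1%:R^-1) * (euler_S R n.+1 - euler_S R n)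
  <= tail_psum n K - tail_psum n.+1 K <= euler_S R n.+1 - euler_S R n.
Proof.
have -> : tail_psum n K - tail_psum n.+1 K
  = \int[leb]_(s in `]0, 1[)
      (s * (\sum_(0 <= k < K) bet0 n k.+1 * mom_prod k s)) :> R.
  rewrite /tail_psum -sumrB.
  have -> : \sum_(0 <= i < K) (bet0 n i * moment i - bet0 n.+1 i * moment i)
    = \sum_(0 <= i < K) bet0 n i.+1 * moment i :> R.
    apply: eq_bigr => k _; rewrite -mulrBl (bet_split n k zero01); congr (_ * _); ring.
  elim: K => [|K IH].
    rewrite big_geq//; under eq_Rintegral do rewrite big_geq// mulr0.
    by rewrite Rintegral_cst// mul0r.
  rewrite big_nat_recr//= IH /moment -RintegralZl//; last exact: integrable_mom.
  rewrite -RintegralD//.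
  - by apply: eq_Rintegral => s _; rewrite big_nat_recr//=; ring.
  - exact: integrable_sum_mom.
  - by apply: integrable_cmul; exact: integrable_mom.
have n1 : 0 < n.+1%:R :> R by [].
have cD (s : R) : 0 <= s <= 1 ->
    {for s, continuous (fun s : R => s * (n.+1%:R * (n.+1%:R + s))^-1)}.
  move=> /andP[s0 s1]; apply: continuousM; first exact: cvg_id.
  apply: continuousV; first by rewrite gt_eqF// mulr_gt0// ltr_wpDr.
  apply: continuousM; first exact: cvg_cst.
  by apply: continuousD; [exact: cvg_cst | exact: cvg_id].
have iD := continuous_integrable_oo cD.
have iS := integrable_sum_mom n K.
rewrite -Rintegral_euler_S_step; apply/andP; split.
- rewrite -RintegralZl//; apply: le_Rintegral => //; first exact: integrable_cmul.
  move=> s; rewrite /= in_itv/= => /andP[s0 s1].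
  have s0' := ltW s0; have s1' := ltW s1.
  have d0 : 0 <= (n.+1%:R * (n.+1%:R + s))^-1 by rewrite invr_ge0 mulr_ge0// addr_ge0.
  rewrite sum_mom_prod// mulrCA ler_wpM2l// ler_wpM2r// lerD2l lerN2.
  have /andP[h0 h] : 0 <= mom_prod K s <= K.+1%:R^-1 by apply: mom_prod_bounds; rewrite s0' s1'.
  have := @bet0_le R n K; have := @bet_ge0 R 0 n K => b0 b1.
  apply: (@le_trans _ _ (n.+1%:R * K.+1%:R * (n.+1%:R^-1 / K.+1%:R) * K.+1%:R^-1)).
    apply: ler_pM => //; first by rewrite !mulr_ge0.
    by rewrite ler_wpM2l// mulr_ge0.
  by rewrite mulrACA !divff ?pnatr_eq0// mulr1 mul1r.
- apply: le_Rintegral => // s; rewrite /= in_itv/= => /andP[s0 s1].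
  have s0' := ltW s0; have s1' := ltW s1.
  have d0 : 0 <= (n.+1%:R * (n.+1%:R + s))^-1 by rewrite invr_ge0 mulr_ge0// addr_ge0.
  rewrite sum_mom_prod// ler_wpM2l// -[leRHS]mul1r ler_wpM2r//.
  have /andP[h0 h] : 0 <= mom_prod K s <= K.+1%:R^-1 by apply: mom_prod_bounds; rewrite s0' s1'.
  by rewrite lerBlDr lerDl !mulr_ge0 ?bet_ge0.
Qed.

(** It equals [gamma - S_n], by [gamma_sub_euler_S]. *)
Definition gamma_tail {R : realType} (n : nat) : R := limn (@tail_psum R n).

Lemma gamma_tail_bounds {R : realType} (n : nat) : 0 <= (gamma_tail n : R) <= 2 / n.+1%:R.
Proof.
apply/andP; split.
  apply: limr_ge; first exact: is_cvg_tail_psum.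
  apply: nearW => K; have := @nondecreasing_tail_psum R n 0 K (leq0n K).
  by rewrite {1}/tail_psum big_geq.
apply: limr_le; first exact: is_cvg_tail_psum.
by apply: nearW => K; exact: tail_psum_le.
Qed.

Lemma gamma_tail_step {R : realType} (n : nat) :
  gamma_tail n - gamma_tail n.+1 = euler_S R n.+1 - euler_S R n.
Proof.
have c1 : (tail_psum n K - tail_psum n.+1 K : R) @[K --> \oo]
    --> (gamma_tail n - gamma_tail n.+1 : R).
  by apply: cvgB; apply: is_cvg_tail_psum.
have c2 : (tail_psum n K - tail_psum n.+1 K : R) @[K --> \oo]
    --> (euler_S R n.+1 - euler_S R n : R).
  set d := euler_S R n.+1 - _.
  apply: (@squeeze_cvgr _ _ _ _ (fun K => (1 - harmonic K) * d) (cst d)).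
  - by apply: nearW => K; exact: tail_psum_step.
  - rewrite -[X in _ --> X]mul1r; apply: cvgMl.
    rewrite -[X in _ --> X]subr0; apply: cvgB; first exact: cvg_cst.
    exact: cvg_harmonic.
  - exact: cvg_cst.
by have := cvg_unique _ c1 c2; apply.
Qed.

(** The two terms change by opposite amounts as [n] grows, and [S_0 = 0]. *)
Lemma euler_S_gamma_tail {R : realType} (n : nat) : euler_S R n + gamma_tail n = gamma_tail 0.
Proof.
elim: n => [|n IH].
  by rewrite {1}/euler_S big_geq// ln1 subrr add0r.
rewrite -IH; have := @gamma_tail_step R n.
by generalize (@gamma_tail R n) (@gamma_tail R n.+1) (euler_S R n) (euler_S R n.+1) => *; lra.
Qed.

Lemma cvg_gamma_tail {R : realType} : (gamma_tail n : R) @[n --> \oo] --> (0 : R).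
Proof.
apply: (@squeeze_cvgr _ _ _ _ (cst 0) (fun n => 2 * harmonic n)).
- by apply: nearW => n; exact: gamma_tail_bounds.
- exact: cvg_cst.
- by rewrite -[X in _ --> X](mulr0 2); apply: cvgMr; exact: cvg_harmonic.
Qed.

Lemma euler_gammaE {R : realType} : euler_gamma R = gamma_tail 0.
Proof.
apply: cvg_lim => //; rewrite -cvg_shiftS.
(* [euler_gamma] subtracts [ln n] where [euler_S] subtracts [ln (n+1)]; after a shift by one, which
   avoids [ln 0], the discrepancy is the last logarithm and tends to 0. *)
have -> : (fun n => \sum_(1 <= k < n.+2) k%:R^-1 - ln n.+1%:R)
  = (fun n => gamma_tail 0 - gamma_tail n.+1 + ln (1 + n.+1%:R^-1)) :> (nat -> R).
  apply/funext => n; rewrite -(@euler_S_gamma_tail R n.+1) /euler_S addrK.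
  have -> : n.+2%:R = n.+1%:R * (1 + n.+1%:R^-1) :> R.
    by rewrite mulrDr mulr1 divff ?pnatr_eq0// natr1.
  by rewrite lnM ?posrE ?addr_gt0 ?invr_gt0//; ring.
suff : (gamma_tail 0 - gamma_tail n.+1 + ln (1 + n.+1%:R^-1) : R) @[n --> \oo]
    --> (gamma_tail 0 - 0 + 0 : R) by rewrite subr0 addr0.
apply: cvgD.
  apply: cvgB; first exact: cvg_cst.
  by rewrite (cvg_shiftS (@gamma_tail R)); exact: cvg_gamma_tail.
apply: (@squeeze_cvgr _ _ _ _ (cst 0) harmonic).
- apply: nearW => n; apply/andP; split; first by rewrite ln_ge0// lerDl invr_ge0.
  by apply: le_ln1Dx; rewrite (lt_trans (y := 0)).
- exact: cvg_cst.
- exact: cvg_harmonic.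
Qed.

Lemma gamma_sub_euler_S {R : realType} (n : nat) :
  euler_gamma R - euler_S R n = gamma_tail n.
Proof. by rewrite euler_gammaE -(@euler_S_gamma_tail R n); ring. Qed.

(** * Tonelli and the integral representation *)

Notation oo01 := (`]0%R, 1%R[%classic).

(** Extension by zero outside the open unit square, so that Tonelli on the whole plane applies. *)
Definition sqr_restrict {R : realType} (f : R * R -> R) (z : R * R) : \bar R :=
  (f z * \1_oo01 z.1 * \1_oo01 z.2)%:E.

Lemma measurable_sqr_restrict {R : realType} (f : R * R -> R) :
  measurable_fun setT f -> measurable_fun setT (sqr_restrict f).
Proof.
move=> mf; apply/measurable_EFinP; apply: measurable_funM; first apply: measurable_funM => //.
- by apply: measurableT_comp measurable_fst; exact: measurable_indic.
- by apply: measurableT_comp measurable_snd; exact: measurable_indic.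
Qed.

Lemma sqr_restrict_ge0 {R : realType} (f : R * R -> R) :
  (forall x y, 0 < x < 1 -> 0 < y < 1 -> 0 <= f (x, y)) ->
  forall z, (0 <= sqr_restrict f z)%E.
Proof.
move=> f0 [x y]; rewrite lee_fin /= !indicE.
case: (boolP (x \in oo01)) => xD; last by rewrite mulr0 mul0r.
case: (boolP (y \in oo01)) => yD; last by rewrite mulr0.
rewrite !mulr1 f0//; [move: xD | move: yD]; by rewrite inE/= in_itv.
Qed.

Lemma int_sqr_restrict1 {R : realType} (f : R * R -> R) (y : R) :
  (\int[leb]_x sqr_restrict f (x, y)
  = ((fun y => \int[leb]_(x in oo01) (f (x, y))%:E) \_ oo01) y)%E.
Proof.
rewrite patchE; case: (boolP (y \in oo01)) => yD.
  rewrite [RHS]integral_mkcond; apply: eq_integral => x _.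
  rewrite patchE /sqr_restrict/= !indicE yD mulr1.
  by case: (boolP (x \in oo01)) => xD; rewrite ?mulr1 ?mulr0.
rewrite (@eq_integral _ _ _ _ _ (cst 0%E)) ?integral0// => x _.
by rewrite /sqr_restrict/= !indicE (negbTE yD) mulr0.
Qed.

Lemma int_sqr_restrict2 {R : realType} (f : R * R -> R) (x : R) :
  (\int[leb]_y sqr_restrict f (x, y)
  = ((fun x => \int[leb]_(y in oo01) (f (x, y))%:E) \_ oo01) x)%E.
Proof.
rewrite patchE; case: (boolP (x \in oo01)) => xD.
  rewrite [RHS]integral_mkcond; apply: eq_integral => y _.
  rewrite patchE /sqr_restrict/= !indicE xD mulr1.
  by case: (boolP (y \in oo01)) => yD; rewrite ?mulr1 ?mulr0.
rewrite (@eq_integral _ _ _ _ _ (cst 0%E)) ?integral0// => y _.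
by rewrite /sqr_restrict/= !indicE (negbTE xD) mulr0 mul0r.
Qed.

Lemma tonelli_oo01 {R : realType} (f : R * R -> R) : measurable_fun setT f ->
  (forall x y, 0 < x < 1 -> 0 < y < 1 -> 0 <= f (x, y)) ->
  (\int[leb]_(x in oo01) \int[leb]_(y in oo01) (f (x, y))%:E
  = \int[leb]_(y in oo01) \int[leb]_(x in oo01) (f (x, y))%:E)%E.
Proof.
move=> mf f0; rewrite integral_mkcond [RHS]integral_mkcond.
transitivity (\int[leb]_x \int[leb]_y sqr_restrict f (x, y))%E.
  by apply: eq_integral => x _; rewrite int_sqr_restrict2.
have -> := @fubini_tonelli _ _ _ _ R leb leb _ (measurable_sqr_restrict mf) (sqr_restrict_ge0 f0).
by apply: eq_integral => y _; rewrite int_sqr_restrict1.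
Qed.

Lemma measurable_int_oo01 {R : realType} (f : R * R -> R) : measurable_fun setT f ->
  (forall x y, 0 < x < 1 -> 0 < y < 1 -> 0 <= f (x, y)) ->
  measurable_fun (oo01 : set R) (fun y => \int[leb]_(x in oo01) (f (x, y))%:E)%E.
Proof.
move=> mf f0.
have := @measurable_fun_fubini_tonelli_G _ _ _ _ R leb _
  (measurable_sqr_restrict mf) (sqr_restrict_ge0 f0).
rewrite /fubini_G (funext (int_sqr_restrict1 f)).
by move=> h; apply/(measurable_restrictT _ _).
Qed.

Lemma EFin_Rintegral {R : realType} (f : R -> R) :
  leb.-integrable oo01 (EFin \o f) ->
  (\int[leb]_(x in oo01) (f x)%:E = (\int[leb]_(x in oo01) f x)%:E)%E.
Proof. by move=> fi; rewrite /Rintegral fineK// integrable_fin_num. Qed.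

Lemma omega_ge0 {R : realType} (t : R) : 0 < t -> 0 <= omega t.
Proof.
by move=> t0; rewrite /omega divr_ge0// mulr_ge0 ?addr_ge0 ?sqr_ge0// ltW.
Qed.

Lemma sin_pi_ge0 {R : realType} (s : R) : 0 <= s <= 1 -> 0 <= sin (pi * s).
Proof.
move=> /andP[s0 s1]; have p0 := pi_gt0 R; apply: sin_ge0_pi.
apply/andP; split; first by rewrite mulr_ge0// ltW.
by rewrite -[leRHS]mulr1 ler_pM2l.
Qed.

(** Replace [omega] by its integral over [s] from [pi_omega] and exchange the integrals: the inner
    one becomes [bet s k 0], and the reflection formula turns it into the integrand of [moment]. *)
Lemma omega_moment {R : realType} (k : nat) :
  (\int[leb]_(t in oo01) (omega t * t ^+ k)%:E = (moment k : R)%:E)%E.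
Proof.
have p0 := pi_gt0 R; have pn : pi != 0 :> R by rewrite gt_eqF.
pose f (z : R * R) := pi^-1 * (sin (pi * z.1) * rho z.1 z.2 * z.2 ^+ k).
have mf : measurable_fun setT f.
  apply: measurable_funM => //; apply: measurable_funM; last first.
    by apply: measurable_funX; exact: measurable_snd.
  apply: measurable_funM; last exact: measurable_rho2.
  have ms : measurable_fun setT (fun s : R => sin (pi * s)).
    apply: continuous_measurable_fun => x.
    exact: is_derive1_continuous (is_derive_sinM _ _).
  exact: measurableT_comp ms measurable_fst.
have f0 (x y : R) : 0 < x < 1 -> 0 < y < 1 -> 0 <= f (x, y).
  move=> /andP[x0 x1] /andP[y0 y1]; rewrite /f/= mulr_ge0 ?invr_ge0 ?(ltW p0)//.
  by rewrite !mulr_ge0 ?sin_pi_ge0 ?expR_ge0 ?exprn_ge0 ?(ltW x0) ?(ltW x1) ?(ltW y0).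
have := tonelli_oo01 mf f0.
have -> : (\int[leb]_(y in oo01) \int[leb]_(x in oo01) (f (x, y))%:E
  = \int[leb]_(t in oo01) (omega t * t ^+ k)%:E)%E.
  apply: eq_integral => t; rewrite inE/= in_itv/= => t01.
  have ci : leb.-integrable oo01 (EFin \o (fun s : R => sin (pi * s) * rho s t)).
    apply: continuous_integrable_oo => s _; apply: continuousM.
      exact: is_derive1_continuous (is_derive_sinM _ _).
    exact: is_derive1_continuous (is_derive_rho_s _ _).
  transitivity (\int[leb]_(s in oo01) ((pi^-1 * t ^+ k) * (sin (pi * s) * rho s t))%:E)%E.
    by apply: eq_integral => s _; rewrite /f/=; congr EFin; ring.
  rewrite EFin_Rintegral; last exact: integrable_cmul.
  rewrite RintegralZl// pi_omega//; congr EFin.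
  by rewrite mulrAC mulrA mulVf// mul1r mulrC mulrC.
move=> <-; rewrite /moment -EFin_Rintegral; last exact: integrable_mom.
apply: eq_integral => s; rewrite inE/= in_itv/= => s01.
have s01' : 0 <= s < 1 by have /andP[s0 ->] := s01; rewrite ltW.
transitivity (\int[leb]_(t in oo01) (pi^-1 * sin (pi * s) * bwt s k 0 t)%:E)%E.
  by apply: eq_integral => t _; rewrite /f /bwt/= expr0; congr EFin; ring.
have bi := integrable_bwt k 0 s01'.
rewrite EFin_Rintegral; last exact: integrable_cmul.
rewrite RintegralZl// -/(bet s k 0) -mulrA sin_bet_mom//.
by rewrite mulrA mulVf// mul1r.
Qed.

(** * Power series of the kernel integral *)

Definition kint {R : realType} (n : nat) (t : R) : R :=
  \int[leb]_(x in oo01) xfrac n 1 t x.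

Lemma integrable_xfrac {R : realType} (c d : nat) (t : R) : 0 < t < 1 ->
  leb.-integrable oo01 (EFin \o xfrac c d t).
Proof.
by move=> t01; apply: continuous_integrable_oo => x; exact: continuous_xfrac.
Qed.

Lemma EFin_nneseries {R : realType} (u : nat -> R) (l : R) :
  (\sum_(0 <= k < n) u k) @[n --> \oo] --> l ->
  (\sum_(k <oo) (u k)%:E = l%:E)%E.
Proof.
move=> ul; apply: cvg_lim => //.
have -> : (fun n => (\sum_(0 <= k < n) (u k)%:E)%E)
  = (fun n => (\sum_(0 <= k < n) u k)%:E).
  by apply/funext => n; rewrite sumEFin.
by apply: cvg_EFin => //; exact: nearW.
Qed.

(** Geometric series in [(1 - x) t], because [den t x = 1 - (1 - x) t]. *)
Lemma xfrac_series {R : realType} (n : nat) (t x : R) : 0 < t < 1 -> 0 < x < 1 ->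
  ((xfrac n 1 t x)%:E = \sum_(k <oo) (t ^+ k * bwt 0 n k x)%:E)%E.
Proof.
move=> /andP[t0 t1] /andP[x0 x1]; apply/esym/EFin_nneseries.
have z1 : `|(1 - x) * t| < 1.
  by rewrite ger0_norm ?mulr_ge0 ?subr_ge0 ?ltW//; nra.
have := cvg_geometric_series (a := x ^+ n) z1.
rewrite /xfrac expr1.
have -> : 1 - (1 - x) * t = den t x by rewrite /den; ring.
apply: cvg_trans; apply: near_eq_cvg; apply: nearW => m.
rewrite /series/=; apply: eq_bigr => k _.
by rewrite /geometric/= exprMn /bwt /rho mul0r expR0; ring.
Qed.

Lemma kint_series {R : realType} (n : nat) (t : R) : 0 < t < 1 ->
  ((kint n t)%:E = \sum_(k <oo) (bet0 n k * t ^+ k)%:E)%E.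
Proof.
move=> t01; have /andP[t0 t1] := t01.
rewrite -EFin_Rintegral; last exact: integrable_xfrac.
transitivity (\int[leb]_(x in oo01) \sum_(k <oo) (t ^+ k * bwt 0 n k x)%:E)%E.
  apply: eq_integral => x; rewrite inE/= in_itv/= => x01; exact: xfrac_series.
rewrite integral_nneseries//.
- apply: eq_eseriesr => k _.
  have bi := @integrable_bwt R 0 n k zero01.
  rewrite EFin_Rintegral; last exact: integrable_cmul.
  by rewrite RintegralZl// mulrC.
- move=> k; apply/measurable_EFinP; apply: measurable_funM => //; exact: measurable_bwt.
- move=> k x; rewrite /= in_itv/= => x01.
  by rewrite lee_fin mulr_ge0 ?bwt_ge0// exprn_ge0// ltW.
Qed.

(** All terms are nonnegative, so the series of [kint] is integrated termwise against [omega]; this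
    gives the series defining [gamma_tail] and, its sum being finite, also integrability. *)
Lemma integral_omega_kint {R : realType} (n : nat) :
  (\int[leb]_(t in oo01) (omega t * kint n t)%:E = (gamma_tail n : R)%:E)%E.
Proof.
transitivity (\int[@lebesgue_measure R]_(t in oo01)
    \sum_(k <oo) (bet0 n k * (omega t * t ^+ k))%:E)%E.
  apply: eq_integral => t; rewrite inE/= in_itv/= => t01; have /andP[t0 t1] := t01.
  rewrite EFinM kint_series// -nneseriesZl; last first.
    by move=> k _; rewrite lee_fin mulr_ge0 ?bet_ge0 ?exprn_ge0// ltW.
  by apply: eq_eseriesr => k _; rewrite -EFinM mulrCA.
have mo k : measurable_fun (oo01 : set R) (fun t : R => omega t * t ^+ k).
  apply: measurable_funM; last by apply: measurable_funX.
  by apply: measurable_funTS; exact: measurable_omega.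
have o0 k (t : R) : oo01 t -> 0 <= omega t * t ^+ k.
  rewrite /= in_itv/= => /andP[t0 t1].
  by rewrite mulr_ge0 ?omega_ge0// exprn_ge0// ltW.
rewrite integral_nneseries//.
- transitivity (\sum_(k <oo) (bet0 n k * moment k : R)%:E)%E.
    apply: eq_eseriesr => k _.
    under eq_integral do rewrite EFinM.
    rewrite ge0_integralZl_EFin//; [ | | | exact: bet_ge0].
    2: by move=> t tD; rewrite lee_fin; exact: o0.
    2: by apply/measurable_EFinP; exact: mo.
    by rewrite omega_moment EFinM.
  by apply: EFin_nneseries; exact: is_cvg_tail_psum.
- by move=> k; apply/measurable_EFinP; apply: measurable_funM => //; exact: mo.
- by move=> k t tD; rewrite lee_fin mulr_ge0 ?bet_ge0 ?o0.
Qed.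

Lemma measurable_xfrac2 {R : realType} (c d : nat) :
  measurable_fun setT (fun z : R * R => xfrac c d z.2 z.1).
Proof.
apply: measurable_funM; first by apply: measurable_funX; exact: measurable_fst.
apply: measurable_funV; apply: measurable_funX; apply: measurable_funD.
  by apply: measurable_funB => //; exact: measurable_snd.
by apply: measurable_funM; [exact: measurable_fst | exact: measurable_snd].
Qed.

Lemma measurable_Rintegral_xfrac {R : realType} (g : R -> R) (c d : nat) :
  measurable_fun setT g -> (forall x, 0 < x < 1 -> 0 <= g x) ->
  measurable_fun (oo01 : set R) (fun t => \int[leb]_(x in oo01) (g x * xfrac c d t x)).
Proof.
move=> mg g0; rewrite /Rintegral.
apply: (@measurableT_comp _ _ _ _ _ _ fine); first exact: fine_measurable.
apply: (@measurable_int_oo01 R (fun z => g z.1 * xfrac c d z.2 z.1)).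
  apply: measurable_funM; last exact: measurable_xfrac2.
  by apply: measurableT_comp measurable_fst.
move=> x t x01 t01; have /andP[x0 x1] := x01.
by rewrite mulr_ge0 ?g0// xfrac_ge0// !ltW.
Qed.

Lemma kint_ge0 {R : realType} (n : nat) (t : R) : 0 < t < 1 -> 0 <= kint n t.
Proof.
move=> t01; apply: Rintegral_ge0 => x; rewrite /= in_itv/= => /andP[x0 x1].
by rewrite xfrac_ge0// !ltW.
Qed.

Lemma integrable_omega_kint {R : realType} (n : nat) :
  leb.-integrable oo01 (EFin \o (fun t : R => omega t * kint n t)).
Proof.
apply/integrableP; split.
  apply/measurable_EFinP; apply: measurable_funM.
    by apply: measurable_funTS; exact: measurable_omega.
  have -> : kint n = (fun t : R => \int[leb]_(x in oo01) (cst 1 x * xfrac n 1 t x)).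
    by apply/funext => t; apply: eq_Rintegral => x _; rewrite mul1r.
  exact: measurable_Rintegral_xfrac.
have -> : (\int[@lebesgue_measure R]_(t in oo01) `|(omega t * kint n t)%:E|
  = \int[leb]_(t in oo01) (omega t * kint n t)%:E)%E.
  apply: eq_integral => t; rewrite inE/= in_itv/= => t01; have /andP[t0 _] := t01.
  by rewrite ger0_norm// mulr_ge0 ?omega_ge0 ?kint_ge0.
by rewrite integral_omega_kint ltry.
Qed.

Lemma Rintegral_omega_kint {R : realType} (n : nat) :
  \int[leb]_(t in oo01) (omega t * kint n t) = euler_gamma R - euler_S R n.
Proof. by rewrite gamma_sub_euler_S /Rintegral integral_omega_kint. Qed.

(** * Assembly *)

Lemma Rintegral_lincomb {R : realType} (N : nat) (w : nat -> R) (f : nat -> R -> R) :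
  (forall k, leb.-integrable oo01 (EFin \o f k)) ->
  leb.-integrable oo01 (EFin \o (fun t => \sum_(0 <= k < N) w k * f k t)) /\
  \int[leb]_(t in oo01) (\sum_(0 <= k < N) w k * f k t)
    = \sum_(0 <= k < N) w k * \int[leb]_(t in oo01) f k t.
Proof.
move=> fi; elim: N => [|N [IH1 IH2]].
  have -> : (fun t : R => \sum_(0 <= k < 0) w k * f k t) = cst 0.
    by apply/funext => t; rewrite big_geq.
  split; last by rewrite Rintegral_cst// mul0r big_geq.
  by apply: continuous_integrable_oo => *; exact: cvg_cst.
have -> : (fun t : R => \sum_(0 <= k < N.+1) w k * f k t)
  = (fun t => \sum_(0 <= k < N) w k * f k t + w N * f N t).
  by apply/funext => t; rewrite big_nat_recr.
have wi := integrable_cmul (w N) (fi N).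
split; first by have h := integrableD _ IH1 wi; exact: h.
by rewrite RintegralD// IH2 RintegralZl// [RHS]big_nat_recr.
Qed.

(** Links the alternating sum of the theorem, seen under the integral in [t], to the integrals
    handled by parts. *)
Lemma alt_int_kint {R : realType} (N r c : nat) (es : seq nat) (t : R) : 0 < t < 1 ->
  alt_int N r es c 1 t = \sum_(0 <= k < N.+1)
    ((-1) ^+ k * 'C(N, k)%:R * \prod_(e <- es) ((r * k)%:R + e.+1%:R)) * kint (r * k + c) t.
Proof.
move=> t01; rewrite /alt_int.
have [_ <-] := Rintegral_lincomb N.+1
  (fun k => (-1) ^+ k * 'C(N, k)%:R * \prod_(e <- es) ((r * k)%:R + e.+1%:R))
  (fun k => integrable_xfrac (r * k + c) 1 t01).
apply: eq_Rintegral => x _; rewrite horner_alt_poly mulr_suml; apply: eq_bigr => k _.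
rewrite -[LHS]mulrA; congr (_ * _); last by rewrite /xfrac mulrA exprD.
by congr (_ * _); apply: eq_bigr => e _; rewrite natrM.
Qed.

Lemma alt_int_nil_ge0 {R : realType} (N r c d : nat) (t : R) : 0 < t < 1 ->
  0 <= alt_int N r [::] c d t.
Proof.
move=> t01; apply: Rintegral_ge0 => x /=; rewrite in_itv/= => /andP[x0 x1].
by rewrite alt_poly_nil mulr_ge0 ?xfrac_ge0 ?exprn_ge0 ?subr_ge0 ?exprn_ile1 ?(ltW x0) ?(ltW x1).
Qed.

(** From [den t x - x = (1 - t) (1 - x) >= 0] it follows that [x^c / den^(d+1) <= 1 / den] for
    [d <= c]. This provides the dominating function for [integrable_omega_alt]. *)
Lemma alt_int_nil_le {R : realType} (N r c d : nat) (t : R) : 0 < t < 1 -> (d <= c)%N ->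
  alt_int N r [::] c d.+1 t <= kint 0 t.
Proof.
move=> t01 dc; have /andP[t0 t1] := t01.
apply: le_Rintegral => //; [exact: integrable_alt | exact: integrable_xfrac |].
move=> x; rewrite /= in_itv/= => /andP[x0 x1].
have x0' := ltW x0; have x1' := ltW x1; have xr : x ^+ r <= 1 by rewrite exprn_ile1.
have s0 : 0 < den t x by apply: den_gt0 => //; rewrite x0'.
have xs : x <= den t x by rewrite /den; nra.
rewrite alt_poly_nil; apply: le_trans (ler_piMl _ _) _.
- by rewrite xfrac_ge0// x0'.
- by rewrite exprn_ile1// ?subr_ge0// lerBlDr lerDl exprn_ge0.
rewrite /xfrac expr0 expr1 -(subnK dc) exprD exprS invfM mulrACA mulrC.
rewrite [leRHS]mul1r -[leRHS]mulr1 [leLHS]mulrC.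
have h1 : x ^+ d / den t x ^+ d <= 1 
  by rewrite ler_pdivrMr ?exprn_gt0// mul1r lerXn2r// ?nnegrE ltW.
have h2 : x ^+ (c - d) <= 1 by rewrite exprn_ile1.
rewrite -mulrA mulrCA; apply: ler_wpM2l; first by rewrite invr_ge0 ltW.
by rewrite mulr_ile1 ?exprn_ge0// divr_ge0 ?exprn_ge0// ltW.
Qed.

Lemma measurable_alt_int_nil {R : realType} (N r c d : nat) :
  measurable_fun (oo01 : set R) (alt_int N r [::] c d).
Proof.
have -> : alt_int N r [::] c d
  = (fun t : R => \int[leb]_(x in oo01) ((1 - x ^+ r) ^+ N * xfrac c d t x)).
  by apply/funext => t; apply: eq_Rintegral => x _; rewrite alt_poly_nil.
apply: measurable_Rintegral_xfrac.
  by apply: measurable_funX; apply: measurable_funB => //; exact: measurable_funX.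
by move=> x /andP[x0 x1]; rewrite exprn_ge0// subr_ge0 exprn_ile1// ltW.
Qed.

Lemma integrable_omega_alt {R : realType} (N r c d a b : nat) : (d <= c)%N ->
  leb.-integrable oo01 (EFin \o (fun t : R =>
    omega t * (t ^+ b * (1 - t) ^+ a * alt_int N r [::] c d.+1 t))).
Proof.
move=> dc; apply: (le_integrable _ _ _ (@integrable_omega_kint R 0)) => //.
  apply/measurable_EFinP; apply: measurable_funM.
    by apply: measurable_funTS; exact: measurable_omega.
  apply: measurable_funM; last exact: measurable_alt_int_nil.
  apply: measurable_funM; first exact: measurable_funX.
  by apply: measurable_funX; exact: measurable_funB.
move=> t; rewrite /= in_itv/= => t01; have /andP[t0 t1] := t01.
have t0' := ltW t0; have t1' := ltW t1; have w0 := omega_ge0 t0.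
have A0 := alt_int_nil_ge0 N r c d.+1 t01; have A1 := alt_int_nil_le N r t01 dc.
have u0 : 0 <= 1 - t by rewrite subr_ge0.
have u1 : 1 - t <= 1 by rewrite lerBlDr lerDl.
have p0 : 0 <= t ^+ b * (1 - t) ^+ a by rewrite mulr_ge0// exprn_ge0.
have p1 : t ^+ b * (1 - t) ^+ a <= 1 by rewrite mulr_ile1 ?exprn_ge0// exprn_ile1.
have q0 := mulr_ge0 w0 (mulr_ge0 p0 A0); have k0 := mulr_ge0 w0 (kint_ge0 0 t01).
rewrite lee_fin (ger0_norm q0) (ger0_norm k0); apply: ler_wpM2l => //.
by apply: le_trans A1; rewrite ler_piMl.
Qed.

(** The first [a + b] factors are consumed by the exact identity [alt_int_block]; inequalities enter
    only for the remaining [es]. *)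
Lemma alt_int_main_bound {R : realType} (N r tau a b : nat) (es : seq nat) (t : R) :
  0 < t < 1 -> (a + b + size es <= N)%N -> chain (tau + a + b) (a + b).+1 es ->
  `|alt_int N r (rev (iota tau a) ++ iota (tau + a) b ++ es) (tau + a) 1 t|
  <= ((a + b)`!%:R * \prod_(e <- es) ((tau + a + b)%:R - e%:R))
     * (t ^+ b * (1 - t) ^+ a * alt_int N r [::] (tau + a + b) (a + b).+1 t).
Proof.
move=> t01 sN ch; have /andP[t0 t1] := t01.
have sN' : (size es <= N)%N by apply: leq_trans sN; rewrite leq_addl.
have /andP[h0 h1] := @alt_int_bounds R N r _ _ es t t01 sN' ch.
have e1 : `|1 - t| = 1 - t by rewrite ger0_norm// subr_ge0 ltW.
have e2 : `|t| = t by rewrite gtr0_norm.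
rewrite alt_int_block// !normrM !normrX normrN e1 e2 normr_nat.
set P := \prod_(e <- es) _ in h1 *; set H := alt_int _ _ [::] _ _ _ in h1 *.
set J := alt_int _ _ _ _ _ _ in h0 h1 *.
have hJ : `|J| <= P * H.
  apply: le_trans h1; rewrite -[leRHS]ger0_norm// normrM normrX normrN1.
  by rewrite expr1n mul1r.
have -> : (a + b)`!%:R * P * (t ^+ b * (1 - t) ^+ a * H)
  = (1 - t) ^+ a * t ^+ b * (a + b)`!%:R * (P * H) by ring.
apply: ler_wpM2l => //.
by rewrite !mulr_ge0// exprn_ge0// ?subr_ge0 ltW.
Qed.

Theorem theorem4 (R : realType) (m r : nat) (n tau : nat -> nat) (N : nat)
  (m_ge1 : (1 <= m)%N)
  (r_gt0 : (0 < r)%N)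
  (n_gt0 : forall j : nat, (1 <= j <= m)%N -> (0 < n j)%N)
  (tau0_ge : (tau m <= tau 0%N)%N)
  (tau0_le : (tau 0%N - tau m <= n m)%N)
  (tau_incr : forall j : nat, (1 <= j <= m - 1)%N ->
     (tau j.+1 <= n m + tau m)%N /\ (n j + tau j < tau j.+1)%N)
  (N_def : N = (\sum_(1 <= j < m.+1) n j)%N) :
  `| N`!%:R * (- r%:R) ^+ N / (\prod_(1 <= j < m.+1) (n j)`!%:R) * euler_gamma R
     - \sum_(0 <= k < N.+1)
         (-1) ^+ k * 'C(N, k)%:R
         * (\prod_(1 <= j < m.+1) 'C(r * k + n j + tau j, n j)%:R)
         * euler_S R (r * k + tau 0%N) |
  <= (\prod_(1 <= j < m.+1) 'C(n m + tau m - tau j, n j)%:R)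
     * \int[lebesgue_measure]_(t in `]0%R, 1%R[)
         (\int[lebesgue_measure]_(x in `]0%R, 1%R[)
           (x ^+ (n m + tau m) * (1 - x ^+ r) ^+ N
             * t ^+ (n m + tau m - tau 0%N) * (1 - t) ^+ (tau 0%N - tau m)
             * omega t
             / (1 - t + x * t) ^+ (n m).+1)).
Proof.
(* [tau 0] cuts the last block [tau m, ..., tau m + n m - 1] into a lower part of length [a] and an
   upper part of length [b]; [M] is the exponent of [x] once this block is consumed. *)
pose M := (n m + tau m)%N; pose a := (tau 0 - tau m)%N; pose b := (n m - a)%N.
have nE : (n m = a + b)%N by rewrite /b /a subnKC.
have t0E : (tau 0 = tau m + a)%N by rewrite /a subnKC.
have ME : (M = tau m + a + b)%N by rewrite /M nE addnC addnA.
have MtE : (n m + tau m - tau 0 = b)%N by rewrite -/M ME t0E addKn.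
have m1 : (1 <= m.+1)%N by [].
have mE : m = m.-1.+1 by rewrite prednK.
pose bl := blocks n tau m.-1.
(* The initial power of [x] is [tau 0 = tau m + a]: the lower part is taken downwards from there,
   then the upper part upwards, then the blocks [m - 1] to 1. *)
pose es := rev (iota (tau m) a) ++ iota (tau m + a) b ++ bl.
have split_m (T : Type) (idx : T) (op : Monoid.com_law idx) (f : nat -> T) :
    \big[op/idx]_(1 <= j < m.+1) f j = op (\big[op/idx]_(1 <= j < m.-1.+1) f j) (f m).
  by rewrite big_nat_recr//= -mE.
have size_es : size es = N.
  rewrite N_def split_m -(size_blocks n tau) !size_cat size_rev !size_iota addnA -nE.
  by rewrite addnC.
(* The last block leaves the denominator exponent [n m + 1]; the gap condition at [m - 1] then
   bounds the first remaining block, if any. *)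
have ch : chain (tau m + a + b) (a + b).+1 bl.
  apply: chain_blocks => [i im|m0].
    by have [] := tau_incr i ltac:(lia).
  by have [] := tau_incr m.-1 ltac:(lia); rewrite -mE; lia.
have prod_es (f : nat -> R) :
    \prod_(e <- es) f e = \prod_(1 <= j < m.+1) \prod_(e <- iota (tau j) (n j)) f e.
  rewrite split_m -prod_blocks /es -/bl !big_cat/= mulrA mulrC; congr (_ * _).
  rewrite nE iotaD big_cat/=; congr (_ * _).
  by apply: perm_big; rewrite perm_rev.
(* Scaling by [F] turns the binomials into products of linear factors, one for each entry of
   [es]. *)
pose F : R := \prod_(1 <= j < m.+1) (n j)`!%:R.
have F0 : 0 < F by apply: prodr_gt0 => j _; rewrite ltr0n fact_gt0.
have prod_up k : \prod_(e <- es) ((r * k)%:R + e.+1%:R)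
    = F * \prod_(1 <= j < m.+1) 'C(r * k + n j + tau j, n j)%:R :> R.
  rewrite prod_es /F -big_split/=; apply: eq_bigr => j _.
  by rewrite prod_iota_up -bin_ffact natrM mulrC.
pose w k : R := (-1) ^+ k * 'C(N, k)%:R * \prod_(e <- es) ((r * k)%:R + e.+1%:R).
(* There are exactly [N] factors, which is the nonvanishing case of [diff_sum_prod]. *)
have sum_w : \sum_(0 <= k < N.+1) w k = N`!%:R * (- r%:R) ^+ N.
  have := @diff_sum_prod R r%:R [seq e.+1%:R | e <- es] N.
  rewrite size_map size_es leqnn eqxx => /(_ isT) <-.
  apply: eq_bigr => k _; rewrite /w; congr (_ * _); rewrite big_map.
  by apply: eq_bigr => e _; rewrite natrM.
set Z := (X in `|X|).
have FZ : F * Z = \sum_(0 <= k < N.+1)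
    w k * (euler_gamma R - euler_S R (r * k + tau 0)).
  have -> : \sum_(0 <= k < N.+1) w k * (euler_gamma R - euler_S R (r * k + tau 0))
    = (\sum_(0 <= k < N.+1) w k) * euler_gamma R
      - \sum_(0 <= k < N.+1) w k * euler_S R (r * k + tau 0).
    by rewrite mulr_suml -sumrB; apply: eq_bigr => k _; rewrite mulrBr.
  rewrite sum_w /Z mulrBr -/F; congr (_ - _).
    by rewrite mulrA [F * _]mulrC divfK// gt_eqF.
  rewrite mulr_sumr; apply: eq_bigr => k _; rewrite /w prod_up; ring.
have intG : F * Z = \int[leb]_(t in oo01)
    (\sum_(0 <= k < N.+1) w k * (omega t * kint (r * k + tau 0) t)).
  have [_ ->] := Rintegral_lincomb N.+1 w
    (fun k => @integrable_omega_kint R (r * k + tau 0)).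
  by rewrite FZ; apply: eq_bigr => k _; rewrite Rintegral_omega_kint.
have [iG _] := Rintegral_lincomb N.+1 w
  (fun k => @integrable_omega_kint R (r * k + tau 0)).
pose h (t : R) := omega t * (t ^+ b * (1 - t) ^+ a * alt_int N r [::] M (n m).+1 t).
have ih : leb.-integrable oo01 (EFin \o h).
  by apply: integrable_omega_alt; rewrite /M leq_addr.
have rhs : \int[leb]_(t in oo01) (\int[leb]_(x in oo01)
    (x ^+ (n m + tau m) * (1 - x ^+ r) ^+ N
     * t ^+ (n m + tau m - tau 0) * (1 - t) ^+ (tau 0 - tau m)
     * omega t / (1 - t + x * t) ^+ (n m).+1)) = \int[leb]_(t in oo01) h t.
  apply: eq_Rintegral => t; rewrite inE/= in_itv/= => t01.
  rewrite /h mulrA -RintegralZl//; last exact: integrable_alt.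
  apply: eq_Rintegral => x _; rewrite MtE -/M -/a alt_poly_nil /xfrac /den; ring.
pose P : R := \prod_(1 <= j < m.+1) 'C(n m + tau m - tau j, n j)%:R.
(* The binomial of index [m] in [P] is 1, and the other blocks give falling factorials of
   [M - tau j]; the condition on [tau j.+1] ensures [tau j + n j <= M]. *)
have prod_down : (n m)`!%:R * \prod_(e <- bl) (M%:R - e%:R) = F * P :> R.
  rewrite /F /P !split_m /= -/M prod_blocks addnK binn mulr1 [LHS]mulrC [RHS]mulrAC.
  congr (_ * _); rewrite -big_split/= big_nat [RHS]big_nat; apply: eq_bigr => j jm.
  have [h1 h2] := tau_incr j ltac:(lia).
  by rewrite prod_iota_down -?bin_ffact ?natrM 1?mulrC//; rewrite /M; lia.
suff : F * `|Z| <= F * (P * \int[leb]_(t in oo01) h t).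
  by rewrite ler_pM2l// rhs.
rewrite -{1}(gtr0_norm F0) -normrM intG.
apply: le_trans (le_normr_Rintegral _ _) _ => //.
rewrite mulrA -RintegralZl//; apply: le_Rintegral => //.
- exact: integrable_norm.
- exact: integrable_cmul.
move=> t; rewrite /= in_itv/= => t01; have /andP[t0 t1] := t01.
(* From here the estimate is pointwise in [t]: the alternating sum becomes one integral to which the
   integration by parts applies. *)
have -> : \sum_(0 <= k < N.+1) w k * (omega t * kint (r * k + tau 0) t)
  = omega t * alt_int N r es (tau m + a) 1 t.
  rewrite alt_int_kint// -t0E mulr_sumr; apply: eq_bigr => k _.
  by rewrite -/(w k) mulrCA.
rewrite normrM (ger0_norm (omega_ge0 t0)) /h mulrCA; apply: ler_wpM2l.
  exact: omega_ge0.
apply: le_trans (alt_int_main_bound _ t01 _ ch) _.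
  by rewrite -size_es !size_cat size_rev !size_iota addnA.
by rewrite -ME -nE prod_down.
Qed.
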